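(* Consider a collection of $k\ge 1$ gadget pattern pairs $\{(G_j^a,G_j^r)\mid 1\le j\le k\}$ for a minimization problem $B$ whose objective function is additive with respect to the gadgets. Let $\mathcal U_1,\dots,\mathcal U_m$ each be subuniverses for the collection of gadget pattern pairs, and let the universe $\mathcal U$ be the union of the subuniverses (where the number $m$ of subuniverses can be chosen arbitrarily large). Assume that, with respect to the subuniverses, the gadget pattern pairs satisfy the consistency condition for $B$, the first item condition, the distinguishing decision condition, and the disjoint copies condition. Let $s$ be the maximum number of input items in any gadget pattern in the collection. Suppose the values $\mathrm{OPT}(G_j^a),\mathrm{BAD}(G_j^a),\mathrm{OPT}(G_j^r),\mathrm{BAD}(G_j^r)$ are independent of $j$, and denote them by $\mathrm{OPT}(G^a),\mathrm{BAD}(G^a),\mathrm{OPT}(G^r),\mathrm{BAD}(G^r)$; assume that $\mathrm{OPT}(G^r)\ge \mathrm{OPT}(G^a)$. Define $$\rho=\min\left\{\frac{\mathrm{BAD}(G^a)}{\mathrm{OPT}(G^a)},\frac{\mathrm{BAD}(G^r)}{\mathrm{OPT}(G^r)}\right\}.$$ Then for any $\epsilon\in(0,\tfrac12]$, no adaptive priority algorithm for $B$ in the oblivious priority function model using fewer than $(1-H(\epsilon))n/s$ advice bits, where $n$ is the number of input items, can achieve an approximation ratio smaller than $$1+\frac{\epsilon(\rho-1)\,\mathrm{OPT}(G^a)}{\epsilon\,\mathrm{OPT}(G^a)+(1-\epsilon)\,\mathrm{OPT}(G^r)}.$$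
   Context: $H(p)=-p\log_2 p-(1-p)\log_2(1-p)$ is the binary entropy function. **Adaptive priority algorithm with advice.** There is a universe $\mathcal U$ of input items; an input is a finite multiset $X$ of items. An oracle that knows the algorithm and all of $X$ (and how ties will be broken) writes an infinite binary advice tape. The deterministic algorithm may first read some bits of the tape, sequentially. Then, in iteration $i=1,2,\dots$ until $X$ is empty, it specifies a priority function $P_i:\mathcal U\to\mathbb R$, receives an item $x_i$ of the remaining input $X$ maximizing $P_i$ (ties broken adversarially), which is removed from $X$, reads zero or more further advice bits, and makes an irrevocable decision $d_i$. The decision and the number of bits read are functions of the items received, the advice read and the decisions made so far. Advice used is the number of bits read. *Oblivious priority function model*: $P_i$ may depend on $x_1,\dots,x_{i-1}$ and the advice read so far, but must give the same priority to all input items that are indistinguishable when ignoring names not present in the items already received (e.g., for unweighted graph problems, vertices of the same degree where neither the vertices nor their neighbors have been seen yet get the same priority). **Problem $B$.** A decision (''accept'' or ''reject'') is made for every input item. The objective function assigns to the input items and decisions a value in $\mathbb R\cup\{\pm\infty\}$ ($\pm\infty$ for infeasibility) and is invariant under simultaneous permutation of items and decisions. The approximation ratio of an algorithm for a minimization problem is the worst case over inputs of its objective value divided by the optimal value. **Gadgets.** A *gadget* for $B$ is a constant-sized instance of $B$, i.e., a collection of input items satisfying the consistency conditions for $B$ (the conditions for a collection of items to be a valid input; e.g., for a graph problem where an item is a vertex name with a list of neighbor names, $u$ is listed as a neighbor of $v$ iff $v$ is listed as a neighbor of $u$). A *gadget pattern* is a gadget up to renaming of the names occurring in it; a *gadget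 pattern pair* is a pair $(G^a,G^r)$ of gadget patterns. A *subuniverse* for a collection of gadget pattern pairs is a set of input items over its own set of names containing all input items needed for all isomorphic (renamed) copies of all gadget patterns in the collection. Inputs consist of one gadget, consistent with one of the gadget patterns, from each of the subuniverses. - *Consistency condition*: the chosen input items form valid instances of $B$. - *Disjoint copies condition*: the subuniverses are pairwise disjoint and identical up to renaming, so an input item identifies the subuniverse it is in. - *Additivity with respect to the gadgets*: for any instance formed from a set of gadgets from disjoint subuniverses, the objective value on the instance is the sum of the objective values on the individual gadgets. - *First item condition*: the first input item $\mathit{first}(\mathcal U_i)$ that the algorithm receives from a subuniverse $\mathcal U_i$ identifies a gadget pattern pair $(G^a,G^r)$ of the collection, and the item itself gives no information about which of the two patterns it is in (i.e., for the current priority function $P$, it can be the highest-priority item both in a copy of $G^a$ and in a copy of $G^r$ in $\mathcal U_i$). - *Distinguishing decision condition*: the decision on this first item resulting in the optimal objective value in $G^a$ is different from the decision resulting in the optimal objective value in $G^r$; the optimal decision is ''accept'' for $G^a$ and ''reject'' for $G^r$. $\mathrm{OPT}(G)$ is the best objective value on $G$. $\mathrm{BAD}(G)$ is the best objective value attainable on $G$ after making the wrong (non-optimal) decision on the first item of $G$ presented to the algorithm. *)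

(* Defs.v *)
From HB Require Import structures.
From mathcomp Require Import all_boot all_order all_algebra.
From mathcomp Require Import all_classical all_reals all_analysis.

Set Implicit Arguments.
Unset Strict Implicit.
Unset Printing Implicit Defensive.

Import Order.TTheory GRing.Theory Num.Theory.

Local Open Scope classical_set_scope.
Local Open Scope ring_scope.

Definition binary_entropy (R : realType) (p : R) : R :=
  - p * (ln p / ln 2) - (1 - p) * (ln (1 - p) / ln 2).

(* Input items built from names (a vertex name together with the list of the
   names of its neighbours, say), with the action of the bijective renamings.
   The values of [rename f] for a non-bijective [f] are never used. *)
Record itemType := ItemType {
  name : eqType;
  item : eqType;
  names : item -> seq name;
  rename : (name -> name) -> item -> item;
  rename_id : forall x, rename id x = x;
  rename_comp : forall f g x, bijective f -> bijective g ->
    rename (f \o g) x = rename f (rename g x);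
  rename_eq : forall f g x, bijective f -> bijective g ->
    {in names x, f =1 g} -> rename f x = rename g x;
  names_rename : forall f x, bijective f ->
    names (rename f x) =i map f (names x)
}.
Arguments names {_} _.
Arguments rename {_} _ _.

(* Finite multisets of items are sequences up to [perm_eq]; the decision
   "accept" is [true] and "reject" is [false]. *)
Notation accept := true (only parsing).
Notation reject := false (only parsing).

(* [valid] is the consistency condition for a collection of items to be an
   instance of the problem. *)
Record problem (R : realType) (I : itemType) := Problem {
  valid : seq (item I) -> Prop;
  objective : seq (item I * bool) -> \bar R;
  valid_perm : forall X Y, perm_eq X Y -> valid X -> valid Y;
  objective_perm : forall D E, perm_eq D E -> objective D = objective E
}.

Section Values.
Variables (R : realType) (I : itemType) (B : problem R I).

Definition OPT (X : seq (item I)) : \bar R :=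
  \big[Order.min/+oo%E]_(d : (size X).-tuple bool) objective B (zip X d).

(* The best objective value on X once decision d is made on (one occurrence
   of) the item x of X. *)
Definition best_after (X : seq (item I)) (x : item I) (d : bool) : \bar R :=
  \big[Order.min/+oo%E]_(e : (size (rem x X)).-tuple bool)
    objective B ((x, d) :: zip (rem x X) e).

Definition optimal_decision (X : seq (item I)) (x : item I) (d : bool) : bool :=
  best_after X x d == OPT X.

Definition BAD (X : seq (item I)) (x : item I) : \bar R :=
  \big[Order.min/+oo%E]_(d : bool | ~~ optimal_decision X x d)
    best_after X x d.

End Values.

Section Gadgets.
Variables (R : realType) (I : itemType).

(* A gadget pattern is given by one representative, together with those of its
   items that can play the role of the first item presented to the algorithm:
   BAD and the distinguishing decision refer to these items. Several items may
   be marked, since which item is presented first depends on the priority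
   function. *)
Record pattern := Pattern {
  pattern_items : seq (item I);
  pattern_first : seq (item I)
}.

Definition gadget_pattern (B : problem R I) (p : pattern) : Prop :=
  [/\ valid B (pattern_items p),
      pattern_first p != [::]
    & {subset pattern_first p <= pattern_items p}].

Definition copy_by (f : name I -> name I) (p : pattern) (X : seq (item I)) :
    Prop :=
  bijective f /\ perm_eq X (map (rename f) (pattern_items p)).

(* X is a copy of p inside the set of items U. *)
Definition copy_in (U : set (item I)) (p : pattern) (X : seq (item I)) : Prop :=
  (exists f, copy_by f p X) /\ forall x, x \in X -> U x.

(* In addition, x plays in X the role of a marked first item of p. *)
Definition first_copy_in (U : set (item I)) (p : pattern) (x : item I)
    (X : seq (item I)) : Prop :=
  (exists2 f, copy_by f p X & x \in map (rename f) (pattern_first p)) /\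
  forall y, y \in X -> U y.

(* A collection of k gadget pattern pairs is G : 'I_k -> bool -> pattern, where
   G j accept is the pattern G_j^a and G j reject is the pattern G_j^r. *)

Definition gadget_in k (G : 'I_k -> bool -> pattern) (U : set (item I))
    (X : seq (item I)) : Prop :=
  exists j b, copy_in U (G j b) X.

Definition max_items k (G : 'I_k -> bool -> pattern) : nat :=
  \max_(j < k) \max_(b : bool) size (pattern_items (G j b)).

(* U is a subuniverse over the set N of names: all of its names are in N, it
   contains the items of every copy of every pattern over N, and N is large
   enough for each pattern to have such a copy. *)
Definition subuniverse k (G : 'I_k -> bool -> pattern)
    (N : set (name I)) (U : set (item I)) : Prop :=
  let over_N f p := forall x a,
    x \in pattern_items p -> a \in names (rename f x) -> N a in
  [/\ forall x a, U x -> a \in names x -> N a,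
      forall j b f x, bijective f -> over_N f (G j b) ->
        x \in pattern_items (G j b) -> U (rename f x)
    & forall j b, exists2 f, bijective f & over_N f (G j b)].

Definition disjoint_copies_condition m
    (N : 'I_m -> set (name I)) (U : 'I_m -> set (item I)) : Prop :=
  forall i i', i != i' ->
    [/\ N i `&` N i' = set0, U i `&` U i' = set0
      & exists2 f, bijective f & U i' = rename f @` U i].

Definition universe m (U : 'I_m -> set (item I)) : set (item I) :=
  \bigcup_(i in setT) U i.

Definition consistency_condition (B : problem R I) k m
    (G : 'I_k -> bool -> pattern) (U : 'I_m -> set (item I)) : Prop :=
  forall X : 'I_m -> seq (item I), (forall i, gadget_in G (U i) (X i)) ->
    valid B (\big[cat/[::]]_(i < m) X i).

Definition additive_wrt_gadgets (B : problem R I) k m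
    (G : 'I_k -> bool -> pattern) (U : 'I_m -> set (item I)) : Prop :=
  forall (S : {set 'I_m}) (D : 'I_m -> seq (item I * bool)),
    (forall i, i \in S -> gadget_in G (U i) (unzip1 (D i))) ->
    objective B (\big[cat/[::]]_(i in S) D i) =
      (\sum_(i in S) objective B (D i))%E.

(* x and y cannot be told apart when ignoring the names that do not occur in
   the received items s. *)
Definition indistinguishable (s : seq (item I)) (x y : item I) : Prop :=
  exists f : name I -> name I,
    [/\ bijective f, forall z a, z \in s -> a \in names z -> f a = a
      & rename f x = y].

Definition oblivious (U : set (item I)) (s : seq (item I))
    (P : item I -> R) : Prop :=
  forall x y, U x -> U y -> indistinguishable s x y -> P x = P y.

Definition highest_priority (P : item I -> R) (x : item I)
    (X : seq (item I)) : Prop :=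
  x \in X /\ forall y, y \in X -> P y <= P x.

(* Here s is the sequence of items received before the first item x of U i.
   The map [pair] tells which pattern pair is identified by x: it is the pair
   that the gadget of x comes from, and nothing more is revealed. *)
Definition first_item_condition k m
    (G : 'I_k -> bool -> pattern) (U : 'I_m -> set (item I)) : Prop :=
  exists pair : item I -> 'I_k,
    forall (i : 'I_m) (s : seq (item I)) (P : item I -> R)
           (j : 'I_k) (b : bool) (X : seq (item I)) (x : item I),
      (forall y, y \in s -> universe U y /\ ~ U i y) ->
      oblivious (universe U) s P ->
      copy_in (U i) (G j b) X -> highest_priority P x X ->
      pair x = j /\
      forall b', exists2 X', first_copy_in (U i) (G j b') x X'
                           & highest_priority P x X'.

Definition distinguishing_decision_condition (B : problem R I) k m
    (G : 'I_k -> bool -> pattern) (U : 'I_m -> set (item I)) : Prop :=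
  forall (i : 'I_m) (j : 'I_k) (b : bool) (x : item I) (X : seq (item I)),
    first_copy_in (U i) (G j b) x X ->
    forall d, optimal_decision B X x d = (d == b).

(* OPT and BAD of a pattern: the common values on its copies. *)
Definition pattern_OPT (B : problem R I) m (U : 'I_m -> set (item I))
    (p : pattern) (v : \bar R) : Prop :=
  forall i X, copy_in (U i) p X -> OPT B X = v.

Definition pattern_BAD (B : problem R I) m (U : 'I_m -> set (item I))
    (p : pattern) (v : \bar R) : Prop :=
  forall i x X, first_copy_in (U i) p x X -> BAD B X x = v.

Definition gadget_input (B : problem R I) k m
    (G : 'I_k -> bool -> pattern) (U : 'I_m -> set (item I))
    (X : seq (item I)) : Prop :=
  valid B X /\
  exists2 Y : 'I_m -> seq (item I), forall i, gadget_in G (U i) (Y i)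
    & perm_eq X (\big[cat/[::]]_(i < m) Y i).

End Gadgets.

Definition tape := nat -> bool.

(* The number of bits read from a tape when the bits are read one after the
   other: whether to stop depends on the bits already read only. *)
Definition sequential_reading (n : tape -> nat) : Prop :=
  forall t t' : tape, (forall i, (i < n t)%N -> t i = t' i) -> n t' = n t.

Section Algorithms.
Variables (R : realType) (I : itemType).

(* Histories h : seq (item I * bool) list the items received, in order, with
   the decisions made; a : seq bool is the advice read so far. The tape given
   to a reading function is its part not yet read. *)
Record algorithm := Algorithm {
  initial_reading : tape -> nat;
  priority : forall (s : seq (item I)) (a : seq bool), item I -> R;
  reading : forall (h : seq (item I * bool)) (x : item I) (a : seq bool),
    tape -> nat;
  decision : forall (h : seq (item I * bool)) (x : item I) (a : seq bool),
    bool;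
  initial_readingP : sequential_reading initial_reading;
  readingP : forall h x a, sequential_reading (reading h x a)
}.

Definition oblivious_algorithm (U : set (item I)) (A : algorithm) : Prop :=
  forall s a, (forall y, y \in s -> U y) -> oblivious U s (priority A s a).

(* A tie-breaking rule selects, knowing the history, an index in the sequence
   of the remaining items of highest priority. *)
Definition tie_break := seq (item I * bool) -> seq (item I) -> nat.

Definition legal_tie_break (tb : tie_break) : Prop :=
  forall h c, (0 < size c)%N -> (tb h c < size c)%N.

Definition top_items (P : item I -> R) (X : seq (item I)) : seq (item I) :=
  [seq x <- X | all (fun y => P y <= P x) X].

(* Processes the remaining input X, of size at most n; returns the final
   history and all of the advice read. *)
Fixpoint run_from (A : algorithm) (tb : tie_break) (n : nat)
    (X : seq (item I)) (h : seq (item I * bool)) (a : seq bool) (t : tape) :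
    seq (item I * bool) * seq bool :=
  match n, X with
  | n'.+1, x0 :: _ =>
    let c := top_items (priority A (unzip1 h) a) X in
    let x := nth x0 c (tb h c) in
    let r := reading A h x a t in
    let a' := a ++ mkseq t r in
    run_from A tb n' (rem x X) (rcons h (x, decision A h x a')) a'
      (fun i => t (r + i)%N)
  | _, _ => (h, a)
  end.

Definition run (A : algorithm) (tb : tie_break) (X : seq (item I)) (t : tape) :=
  let r := initial_reading A t in
  run_from A tb (size X) X [::] (mkseq t r) (fun i => t (r + i)%N).

Definition advice_used (A : algorithm) tb X t : nat := size (run A tb X t).2.

Definition cost (B : problem R I) (A : algorithm) tb X t : \bar R :=
  objective B (run A tb X t).1.

(* The tape is written knowing the whole input and how ties will be broken. *)
Definition oracle := seq (item I) -> tie_break -> tape.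

Definition approximation_ratio (B : problem R I) (inputs : set (seq (item I)))
    (A : algorithm) (O : oracle) : \bar R :=
  ereal_sup [set r | exists X tb,
    [/\ inputs X, legal_tie_break tb & r = (cost B A tb X (O X tb) / OPT B X)%E]].

End Algorithms.

(* Main.v *)
(* Put a random gadget into every subuniverse: a fair coin chooses between the
   patterns G^a and G^r of one fixed pair, and a random permutation of a finite
   set of names chooses the copy. An oblivious priority function is constant on
   the renamings of an item, so with a suitable tie-breaking rule the first item
   received from a subuniverse is a uniformly renamed copy of an item common to
   both patterns: it carries no information on the coin, and the decision on it
   is wrong with probability 1/2, independently of the past. Hence, for a fixed
   tape, E[z^(number of wrong first decisions)] = ((1+z)/2)^m. Taking
   z = eps/(1-eps) and summing over the 2^C tapes of C < (1-H(eps))m bits gives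
   an input on which every such tape leads to at least eps*m wrong first
   decisions, each of which costs BAD instead of OPT. *)

Require Import Defs.
From HB Require Import structures.
From mathcomp Require Import all_boot all_order all_algebra all_fingroup.
From mathcomp Require Import all_classical all_reals all_analysis.
From mathcomp Require Import ring lra.

Set Implicit Arguments.
Unset Strict Implicit.
Unset Printing Implicit Defensive.

Import Order.TTheory GRing.Theory Num.Theory.
Local Open Scope ring_scope.

(** * Renaming a finite set of names *)

Definition transposition (T : eqType) (v w u : T) : T :=
  if u == v then w else if u == w then v else u.

Lemma transpositionK (T : eqType) (v w : T) : involutive (transposition v w).
Proof.
move=> u; rewrite /transposition.
case: (eqVneq u v) => [->|uv]; first by rewrite eqxx; case: eqVneq.
case: (eqVneq u w) => [->|uw]; first by rewrite eqxx.
by rewrite (negbTE uv) (negbTE uw).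
Qed.

(** Induction on [vs]: the bijection [p] for the tails is followed by the swap of [p v] and [w]. The
    values already prescribed are neither [p v] nor [w], so they survive. *)
Lemma extend_injection (T : eqType) (vs ws : seq T) :
  uniq vs -> uniq ws -> size vs = size ws ->
  exists p : T -> T, [/\ bijective p, map p vs = ws
    & forall u, u \notin vs -> u \notin ws -> p u = u].
Proof.
elim: vs ws => [|v vs IH] [|w ws] //=.
  by move=> _ _ _; exists id; split=> //; exists id.
move=> /andP[vvs uvs] /andP[wws uws] [] /(IH _ uvs uws) [p [bp pvs pid]].
exists (transposition (p v) w \o p); split.
- by apply: bij_comp => //; apply: inv_bij; exact: transpositionK.
- rewrite /= {1}/transposition eqxx -pvs; congr cons; apply/eq_in_map => u uvs'.
  rewrite /= /transposition ifN; last first.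
    by apply: contraNN vvs => /eqP /(bij_inj bp) <-.
  rewrite ifN //; apply: contraNN wws => /eqP <-.
  by rewrite -pvs map_f.
- move=> u; rewrite !inE !negb_or => /andP[uv uvs'] /andP[uw uws'].
  rewrite /= (pid u uvs' uws') /transposition [u == w](negbTE uw) ifN //.
  apply: contraNN uv => /eqP e; apply/eqP/(bij_inj bp).
  by rewrite pid.
Qed.

(** The clause on fixed points will keep the names of received items in place while a fresh item is
    renamed. *)
Lemma extend_partial_injection (T : eqType) (A : seq T) (h : T -> T) :
  {in A &, injective h} ->
  exists p : T -> T, [/\ bijective p, {in A, p =1 h}
    & forall u, u \notin A -> u \notin map h A -> p u = u].
Proof.
move=> hinj.
have [|||p [bp ph pid]] := @extend_injection _ (undup A) (map h (undup A)).
- exact: undup_uniq.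
- by rewrite map_inj_in_uniq ?undup_uniq // => x y; rewrite !mem_undup; exact: hinj.
- by rewrite size_map.
exists p; split=> //.
  move=> x xA; move/eq_in_map: ph; apply; by rewrite mem_undup.
move=> u uA uhA; apply: pid; first by rewrite mem_undup.
apply: contraNN uhA => /mapP[x]; rewrite mem_undup => xA ->.
exact: map_f.
Qed.

Section PermAction.
Variables (T : eqType) (n : nat) (D : n.-tuple T).
Hypothesis uniqD : uniq D.

(** [T] may be infinite; letting ['S_n] permute the entries of [D] and fix everything else gives
    finitely many renamings to average over. *)
Definition perm_act (s : 'S_n) (u : T) : T :=
  if [pick k | tnth D k == u] is Some k then tnth D (s k) else u.

Lemma tnth_injD : injective (tnth D).
Proof. exact/tuple_uniqP. Qed.

Lemma perm_act_tnth s k : perm_act s (tnth D k) = tnth D (s k).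
Proof.
rewrite /perm_act; case: pickP => [k' /eqP/tnth_injD -> //|/(_ k)].
by rewrite eqxx.
Qed.

Lemma perm_act_out s u : u \notin D -> perm_act s u = u.
Proof.
move=> uD; rewrite /perm_act; case: pickP => // k /eqP ku.
by rewrite -ku mem_tnth in uD.
Qed.

Lemma perm_actM (s s' : 'S_n) u :
  perm_act (s * s')%g u = perm_act s' (perm_act s u).
Proof.
have [/tnthP[k ->]|uD] := boolP (u \in D); last by rewrite !perm_act_out.
by rewrite !perm_act_tnth permM.
Qed.

Lemma perm_act1 u : perm_act 1%g u = u.
Proof.
have [/tnthP[k ->]|uD] := boolP (u \in D); last by rewrite !perm_act_out.
by rewrite !perm_act_tnth perm1.
Qed.

Lemma perm_act_bij s : bijective (perm_act s).
Proof.
by exists (perm_act s^-1%g) => u; rewrite -perm_actM ?mulgV ?mulVg perm_act1.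
Qed.

Lemma perm_act_mem s u : (perm_act s u \in D) = (u \in D).
Proof.
have [/tnthP[k ->]|uD] := boolP (u \in D).
  by rewrite perm_act_tnth mem_tnth.
by rewrite perm_act_out // (negbTE uD).
Qed.

Lemma perm_act_extend (A : seq T) (h : T -> T) :
  {in A &, injective h} -> {subset A <= D} -> {subset map h A <= D} ->
  exists s, {in A, perm_act s =1 h}.
Proof.
move=> hinj AD hAD.
have [p [bp ph pid]] := extend_partial_injection hinj.
have pD k : p (tnth D k) \in D.
  have [kA|kA] := boolP (tnth D k \in A); first by rewrite ph // hAD // map_f.
  have [khA|khA] := boolP (tnth D k \in map h A); last by rewrite pid // mem_tnth.
  (* A value of [p] outside [D] lies outside [A] and [map h A], so [p] fixes it; by injectivity it
     equals [tnth D k], which is in [D]. *)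
  apply/negPn/negP => pkD.
  have pp : p (p (tnth D k)) = p (tnth D k).
    by apply: pid; [apply: contraNN pkD => /AD|apply: contraNN pkD => /hAD].
  by move/(bij_inj bp): pp => e; rewrite e mem_tnth in pkD.
have /all_sig[f fE] k : {k' | p (tnth D k) = tnth D k'}.
  by apply: cid; apply/tnthP.
have finj : injective f.
  by move=> k k' e; apply: tnth_injD; apply: (bij_inj bp); rewrite !fE e.
exists (perm finj) => u uA.
have /tnthP[k uk] := AD _ uA.
by rewrite -ph // uk perm_act_tnth permE fE.
Qed.

End PermAction.

(** * Runs of an algorithm *)

Lemma mem_bigcat_ord (T : eqType) m (F : 'I_m -> seq T) x :
  reflect (exists i, x \in F i) (x \in \big[cat/[::]]_(i < m) F i).
Proof.
have -> : (x \in \big[cat/[::]]_(i < m) F i) = [exists i, x \in F i].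
  rewrite (big_morph (fun s => x \in s) (id1 := false) (op1 := orb)) //.
    by rewrite big_has; apply/hasP/existsP => [[i _]|[i]] xi; exists i => //;
      rewrite mem_index_enum.
  by move=> s1 s2; exact: mem_cat.
exact: existsP.
Qed.

Lemma filter_bigcat (T J : Type) (s : seq J) (F : J -> seq T) (p : pred T) :
  [seq x <- \big[cat/[::]]_(i <- s) F i | p x] =
  \big[cat/[::]]_(i <- s) [seq x <- F i | p x].
Proof.
by rewrite (big_morph (seq.filter p) (id1 := [::]) (op1 := cat)) //; exact: filter_cat.
Qed.

Lemma unzip1_bigcat (S T : Type) (J : Type) (s : seq J) (F : J -> seq (S * T)) :
  unzip1 (\big[cat/[::]]_(i <- s) F i) = \big[cat/[::]]_(i <- s) unzip1 (F i).
Proof.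
by rewrite (big_morph (@unzip1 S T) (id1 := [::]) (op1 := cat)) //; exact: map_cat.
Qed.

Lemma size_bigcat (T : Type) (J : Type) (s : seq J) (F : J -> seq T) :
  size (\big[cat/[::]]_(i <- s) F i) = (\sum_(i <- s) size (F i))%N.
Proof.
by rewrite (big_morph size (id1 := 0%N) (op1 := addn)) //; exact: size_cat.
Qed.

Lemma rem_cat (T : eqType) (x : T) s1 s2 :
  rem x (s1 ++ s2) = if x \in s1 then rem x s1 ++ s2 else s1 ++ rem x s2.
Proof.
elim: s1 => //= y s1 IH; rewrite inE eq_sym.
by case: eqVneq => //= _; rewrite IH; case: ifP.
Qed.

Lemma rem_bigcat (T J : eqType) (s : seq J) (F F' : J -> seq T) i x :
  uniq s -> i \in s -> x \in F i -> (forall i', i' != i -> x \notin F i') ->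
  F' i = rem x (F i) -> (forall i', i' != i -> F' i' = F i') ->
  rem x (\big[cat/[::]]_(j <- s) F j) = \big[cat/[::]]_(j <- s) F' j.
Proof.
move=> us + xi xi' Fi Fi'; elim: s us => //= j s IH /andP[js us].
rewrite inE !big_cons rem_cat; case: eqVneq js => [<- js _|ij js /= si].
  rewrite xi Fi; congr cat; rewrite !big_seq; apply: eq_bigr => j' j's.
  by rewrite Fi' //; apply: contraNneq js => <-.
by rewrite (negbTE (xi' _ _)) 1?eq_sym // IH // Fi' // eq_sym.
Qed.

Lemma exists_highest (R : realType) (I : itemType) (P : item I -> R) X :
  X != [::] -> exists x, highest_priority P x X.
Proof.
elim: X => // y [_ _|z X /(_ isT) [x [xX xmax]] _].
  by exists y; split=> [|w]; rewrite inE // => /eqP ->.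
have [xy|yx] := leP (P x) (P y).
  exists y; split; first exact: mem_head.
  by move=> w; rewrite inE => /predU1P[->//|/xmax/le_trans]; apply.
exists x; split; first by rewrite inE xX orbT.
by move=> w; rewrite inE => /predU1P[->|/xmax//]; exact: ltW.
Qed.

Lemma top_itemsP (R : realType) (I : itemType) (P : item I -> R) X x :
  reflect (highest_priority P x X) (x \in top_items P X).
Proof.
rewrite mem_filter andbC; apply: (iffP andP) => -[xX].
  by move/allP.
by move=> xmax; split=> //; apply/allP.
Qed.

Lemma top_items_nonempty (R : realType) (I : itemType) (P : item I -> R) X :
  X != [::] -> top_items P X != [::].
Proof.
by case/(exists_highest P) => x /top_itemsP; case: top_items.
Qed.

(** Decisions are irrevocable: histories only grow, so the first decision in a subuniverse can be
    judged as soon as it is made. *)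
Lemma run_from_prefix (R : realType) (I : itemType) (A : algorithm R I) tb n X
    h a t :
  exists h', (run_from A tb n X h a t).1 = h ++ h'.
Proof.
elim: n X h a t => [|n IH] [|x0 X] h a t; try by exists [::]; rewrite cats0.
rewrite [run_from _ _ _ _ _ _ _]/=; set e := (X in rcons h X).
set X1 := if _ then _ else _; set a1 := _ ++ _; set t1 := (X in run_from _ _ _ _ _ _ X).
have [h' ->] := IH X1 (rcons h e) a1 t1.
by exists (e :: h'); rewrite cat_rcons.
Qed.

(** Quantifying over the default of [nth] frees the received item from the dummy that [run_from]
    takes from the head of the input. *)
Definition received (R : realType) (I : itemType) (P : item I -> R) (tb : tie_break I)
    (h : seq (item I * bool)) (X : seq (item I)) (x : item I) : Prop :=
  forall x0, nth x0 (top_items P X) (tb h (top_items P X)) = x.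

Lemma received_exists (R : realType) (I : itemType) (P : item I -> R) tb h X :
  legal_tie_break tb -> X != [::] ->
  exists2 x, highest_priority P x X & received P tb h X x.
Proof.
move=> tbP X0; case EX: {1}X X0 => [//|y X'] _.
have lt_tb : (tb h (top_items P X) < size (top_items P X))%N.
  by rewrite tbP // lt0n size_eq0 top_items_nonempty // EX.
exists (nth y (top_items P X) (tb h (top_items P X))).
  by apply/top_itemsP; rewrite mem_nth.
by move=> x0; apply: set_nth_default.
Qed.

Lemma run_from_step (R : realType) (I : itemType) (A : algorithm R I) tb n X h a t x
    (r := reading A h x a t) :
  X != [::] -> received (priority A (unzip1 h) a) tb h X x ->
  run_from A tb n.+1 X h a t =
    run_from A tb n (rem x X)
      (rcons h (x, decision A h x (a ++ mkseq t r))) (a ++ mkseq t r)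
      (fun i => t (r + i)%N).
Proof. by rewrite /r; case: X => // x0 X _ /(_ x0) <-. Qed.

Lemma run_from_size_step (R : realType) (I : itemType) (A : algorithm R I) tb X h a t x
    (r := reading A h x a t) :
  x \in X -> received (priority A (unzip1 h) a) tb h X x ->
  run_from A tb (size X) X h a t =
    run_from A tb (size (rem x X)) (rem x X)
      (rcons h (x, decision A h x (a ++ mkseq t r))) (a ++ mkseq t r)
      (fun i => t (r + i)%N).
Proof.
move=> xX xr; have X0 : X != [::] by apply: contraTneq xX => ->.
rewrite -(run_from_step _ _ X0 xr) size_rem // prednK //.
by rewrite lt0n size_eq0.
Qed.

Lemma run_from_perm (R : realType) (I : itemType) (A : algorithm R I) tb n X
    h a t :
  legal_tie_break tb -> (size X <= n)%N ->
  perm_eq (unzip1 (run_from A tb n X h a t).1) (unzip1 h ++ X).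
Proof.
move=> tbP; elim: n X h a t => [|n IH] X h a t sX.
  by move: sX; case: X => //; rewrite cats0.
have [->|X0] := eqVneq X [::]; first by rewrite cats0.
have [x [xX _] xr] := received_exists (priority A (unzip1 h) a) h tbP X0.
rewrite (run_from_step _ _ X0 xr).
apply: perm_trans (IH _ _ _ _ _) _.
  by rewrite size_rem //; case: (X) X0 sX.
rewrite /unzip1 map_rcons -cats1 -catA perm_cat2l /= perm_sym.
exact: perm_to_rem.
Qed.

Lemma advice_run_from (R : realType) (I : itemType) (A : algorithm R I) tb n X h a t :
  (size a <= size (run_from A tb n X h a t).2)%N.
Proof.
elim: n X h a t => [|n IH] [|x0 X] h a t //=.
by apply: leq_trans (IH _ _ _ _); rewrite size_cat leq_addr.
Qed.

Lemma mkseq_eq (t t' : tape) C r :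
  (forall i, (i < C)%N -> t i = t' i) -> (r <= C)%N -> mkseq t r = mkseq t' r.
Proof.
move=> tt' rC; apply/eq_in_map => i; rewrite mem_iota add0n => /= ir.
by rewrite tt' //; exact: leq_trans rC.
Qed.

(** Since reading is sequential, bits beyond the last one read are irrelevant. This replaces
    infinite tapes by the finitely many words of length [C]. *)
Lemma run_from_truncate (R : realType) (I : itemType) (A : algorithm R I) tb n X
    h a t t' C :
  legal_tie_break tb ->
  (size (run_from A tb n X h a t).2 <= size a + C)%N ->
  (forall i, (i < C)%N -> t i = t' i) ->
  run_from A tb n X h a t' = run_from A tb n X h a t.
Proof.
move=> tbP; elim: n X h a t t' C => [|n IH] X h a t t' C szC tt' //.
have [->//|X0] := eqVneq X [::].
have [x [xX _] xr] := received_exists (priority A (unzip1 h) a) h tbP X0.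
move: szC; rewrite !(run_from_step _ _ X0 xr).
set r := reading A h x a t => szC.
have rC : (r <= C)%N.
  have := leq_trans (advice_run_from _ _ _ _ _ _ _) szC.
  by rewrite size_cat size_mkseq leq_add2l.
have -> : reading A h x a t' = r.
  by apply: readingP => i ir; apply: tt'; apply: leq_trans rC.
rewrite -(mkseq_eq tt' rC); apply: (IH _ _ _ _ _ (C - r)%N).
  by rewrite size_cat size_mkseq -addnA subnKC.
by move=> i; rewrite ltn_subRL => /tt'.
Qed.

Lemma run_truncate (R : realType) (I : itemType) (A : algorithm R I) tb X t t' C :
  legal_tie_break tb ->
  (advice_used A tb X t <= C)%N -> (forall i, (i < C)%N -> t i = t' i) ->
  run A tb X t' = run A tb X t.
Proof.
rewrite /advice_used /run; set r := initial_reading A t => tbP szC tt'.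
have rC : (r <= C)%N.
  by have := leq_trans (advice_run_from _ _ _ _ _ _ _) szC; rewrite size_mkseq.
have -> : initial_reading A t' = r.
  by apply: initial_readingP => i ir; apply: tt'; apply: leq_trans rC.
rewrite -(mkseq_eq tt' rC); apply: (@run_from_truncate _ _ _ _ _ _ _ _ _ _ (C - r)) => //.
  by rewrite size_mkseq subnKC.
by move=> i; rewrite ltn_subRL => /tt'.
Qed.

(** * Wrong first decisions on random gadgets *)

Section RandomGadgets.
Variables (R : realType) (I : itemType) (m : nat) (U : 'I_m -> set (item I)).
(** A pair in [bool * T] chooses a gadget: the coin selects the pattern, the second component the
    renaming. A key selects one of the marked items. *)
Variables (T : finType) (K : eqType) (keys : seq K).
Variables (gad : 'I_m -> bool * T -> seq (item I)).
Variables (mark : 'I_m -> K -> bool * T -> item I).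
Variable (A : algorithm R I).

Hypothesis U_disjoint : forall i i' x, U i x -> U i' x -> i = i'.
Hypothesis gad_sub : forall i w x, x \in gad i w -> U i x.
Hypothesis mark_gad : forall i k w, k \in keys -> mark i k w \in gad i w.
(** An injection of a finite type is a permutation, so a marked item has the same distribution under
    both values of the coin. *)
Hypothesis mark_swap : forall i k, k \in keys ->
  exists2 sigma : T -> T, injective sigma
    & forall t, mark i k (false, t) = mark i k (true, sigma t).
(** The key whose marks dominate the gadget may depend on [P], hence a list of keys instead of a
    single one. *)
Hypothesis mark_priority : forall i (s : seq (item I)) (P : item I -> R),
  (forall y, y \in s -> universe U y /\ ~ U i y) ->
  oblivious (universe U) s P ->
  {in keys, forall k w w', P (mark i k w) = P (mark i k w')} /\
  exists2 k, k \in keys & forall w w' y, y \in gad i w -> P y <= P (mark i k w').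
Hypothesis oblA : oblivious_algorithm (universe U) A.

Local Notation choice_of_gadgets := {ffun 'I_m -> bool * T}.

Definition marks (u : choice_of_gadgets) : seq (item I) :=
  [seq mark ik.1 ik.2 (u ik.1) | ik <- [seq (i, k) | i <- enum 'I_m, k <- keys]].

(* Preferring the marked items makes the item received independent of the
   gadgets of the subuniverses from which no item has been received. *)
Definition marks_first (u : choice_of_gadgets) : tie_break I := fun _ c =>
  if [seq x <- marks u | x \in c] is x :: _ then index x c else 0%N.

Lemma marks_first_legal u : legal_tie_break (marks_first u).
Proof.
move=> h c c0; rewrite /marks_first.
case E: [seq x <- marks u | x \in c] => [|x s] //.
have : x \in [seq x <- marks u | x \in c] by rewrite E mem_head.
by rewrite mem_filter index_mem => /andP[].
Qed.

(* Only an error on a marked item counts, since BAD refers to these items. *)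
Definition wrong (i : 'I_m) (w : bool * T) (H : seq (item I * bool)) : bool :=
  if [seq e <- H | `[< U i e.1 >]] is e :: _
  then (e.1 \in [seq mark i k w | k <- keys]) && (e.2 != w.1) else false.

(** * One iteration of a run while the gadgets in the subuniverses of [S] are untouched *)

Section Fresh.
Variables (S : {set 'I_m}) (u0 : choice_of_gadgets) (r : 'I_m -> seq (item I)).
Variables (P : item I -> R) (h : seq (item I * bool)).
Hypothesis r_sub : forall i x, i \notin S -> x \in r i -> U i x.
Hypothesis h_univ : forall y, y \in unzip1 h -> universe U y.
Hypothesis h_fresh : forall i y, i \in S -> y \in unzip1 h -> ~ U i y.
Hypothesis P_obl : oblivious (universe U) (unzip1 h) P.

(** The outcomes still possible once the gadgets outside [S] are known to be those of [u0]. *)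
Definition agree (u : choice_of_gadgets) : bool :=
  [forall i, (i \notin S) ==> (u i == u0 i)].

Definition rest (u : choice_of_gadgets) i := if i \in S then gad i (u i) else r i.

Definition remaining u := \big[cat/[::]]_(i < m) rest u i.

Lemma agreeP (u : choice_of_gadgets) : reflect (forall i, i \notin S -> u i = u0 i) (agree u).
Proof.
apply: (iffP forallP) => uu0 i; last by apply/implyP => /uu0 ->.
by move=> iS; apply/eqP; apply: (implyP (uu0 i)).
Qed.

Lemma rest_sub u i x : x \in rest u i -> U i x.
Proof. by rewrite /rest; case: ifPn => [_ /gad_sub|iS /(r_sub iS)]. Qed.

Lemma mem_remaining u i x : U i x -> (x \in remaining u) = (x \in rest u i).
Proof.
move=> Ux; apply/(sameP (mem_bigcat_ord _ _))/(iffP idP) => [xi|[i' xi']].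
  by exists i.
by rewrite (U_disjoint Ux (rest_sub xi')).
Qed.

Lemma fresh_priority i : i \in S ->
  {in keys, forall k w w', P (mark i k w) = P (mark i k w')} /\
  exists2 k, k \in keys & forall w w' y, y \in gad i w -> P y <= P (mark i k w').
Proof.
move=> iS; apply: (mark_priority _ P_obl) => y yh.
by split; [exact: h_univ|exact: (h_fresh iS)].
Qed.

Lemma remaining_nonempty u i : i \in S -> remaining u != [::].
Proof.
move=> iS; have [_ [k kK _]] := fresh_priority iS.
apply/eqP => X0; suff : mark i k (u i) \in remaining u by rewrite X0.
by apply/mem_bigcat_ord; exists i; rewrite /rest iS mark_gad.
Qed.

(** Outside [S] both outcomes leave the same items. A fresh item is dominated by a mark whose
    priority is the same in every outcome, so the maximum does not depend on the outcome. *)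
Lemma highest_indep u u' x x' :
  P x = P x' -> (forall y, y \in remaining u -> P y <= P x) ->
  forall y, y \in remaining u' -> P y <= P x'.
Proof.
move=> <- top y /mem_bigcat_ord [i]; rewrite /rest.
case: ifPn => iS yi; last first.
  by apply: top; apply/mem_bigcat_ord; exists i; rewrite /rest (negbTE iS).
have [_ [k kK /(_ _ (u i) _ yi) Py]] := fresh_priority iS.
apply: le_trans Py _; apply: top; apply/mem_bigcat_ord.
by exists i; rewrite /rest iS mark_gad.
Qed.

Lemma top_mark_indep u u' i k : agree u -> agree u' -> k \in keys ->
  mark i k (u i) \in top_items P (remaining u) ->
  mark i k (u' i) \in top_items P (remaining u').
Proof.
move=> /agreeP uu0 /agreeP u'u0 kK /top_itemsP[xX xtop]; apply/top_itemsP.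
have Ux u1 : U i (mark i k (u1 i)) by apply: (@gad_sub _ (u1 i)); exact: mark_gad.
move: xX; rewrite /highest_priority (mem_remaining _ (Ux u)) (mem_remaining _ (Ux u')) /rest.
case: ifPn => iS xX; split.
- exact: mark_gad.
- by apply: highest_indep xtop; have [PP _] := fresh_priority iS; exact: PP.
- by rewrite u'u0 // -uu0.
- by apply: highest_indep xtop; rewrite u'u0 // -uu0.
Qed.

(** The pairs [(i, k)] whose mark has top priority are the same in all outcomes, and [marks_first]
    takes the first of them. So the outcome affects the received item only through the renaming of a
    mark. *)
Lemma received_dichotomy : remaining u0 != [::] ->
  (exists i x, [/\ i \notin S, x \in r i
     & forall u, agree u -> received P (marks_first u) h (remaining u) x]) \/
  (exists i k, [/\ i \in S, k \in keys
     & forall u, agree u ->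
         received P (marks_first u) h (remaining u) (mark i k (u i))]).
Proof.
move=> X0; have u0u0 : agree u0 by apply/agreeP.
pose J := [seq (i, k) | i <- enum 'I_m, k <- keys].
have JK ik : ik \in J -> ik.2 \in keys by case/allpairsP=> -[i k] [_ ? ->].
pose top (u : choice_of_gadgets) (ik : 'I_m * K) :=
  mark ik.1 ik.2 (u ik.1) \in top_items P (remaining u).
have marksE u : agree u -> [seq x <- marks u | x \in top_items P (remaining u)] =
    [seq mark ik.1 ik.2 (u ik.1) | ik <- [seq ik <- J | top u0 ik]].
  move=> uu0; rewrite /marks filter_map; congr map; apply: eq_in_filter => ik /JK kK.
  by apply/idP/idP; exact: top_mark_indep.
(* If no mark is on top, then no item of a fresh gadget is, since a mark would dominate it; the top
   items are then leftovers of known gadgets. *)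
case EJ: [seq ik <- J | top u0 ik] => [|[i k] J'].
  have fresh_low (u : choice_of_gadgets) i x : agree u -> i \in S -> x \in gad i (u i) ->
      ~ (forall y, y \in remaining u -> P y <= P x).
    move=> uu0 iS xi xtop; have [_ [k kK Pk]] := fresh_priority iS.
    suff : (i, k) \in [seq ik <- J | top u0 ik] by rewrite EJ.
    rewrite mem_filter; apply/andP; split; last first.
      by apply/allpairsP; exists (i, k); rewrite mem_enum.
    apply/(top_mark_indep uu0 u0u0 kK)/top_itemsP; split.
      by apply/mem_bigcat_ord; exists i; rewrite /rest iS mark_gad.
    by move=> y /xtop /le_trans; apply; exact: Pk xi.
  have topE u : agree u ->
      top_items P (remaining u) = top_items P (remaining u0).
    move=> uu0; rewrite /top_items {2 4}/remaining !filter_bigcat.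
    apply: eq_bigr => i _; rewrite /rest; case: ifPn => iS; last first.
      apply: eq_in_filter => x xi.
      by apply/allP/allP; apply: highest_indep.
    rewrite !(@eq_in_filter _ _ pred0) ?filter_pred0 // => x xi;
      by apply/negP => /allP; apply: fresh_low xi.
  left; have := top_items_nonempty P X0.
  case Etop: (top_items P (remaining u0)) => [//|x s] _.
  have /top_itemsP[xX xtop] : x \in top_items P (remaining u0).
    by rewrite Etop mem_head.
  have /mem_bigcat_ord[i] := xX; rewrite /rest; case: ifPn => iS xi.
    by case: (fresh_low _ _ _ u0u0 iS xi).
  exists i, x; split=> // u uu0 x0.
  by rewrite /marks_first marksE // EJ topE // Etop.
have [kK] : k \in keys /\ top u0 (i, k).
  have : (i, k) \in [seq ik <- J | top u0 ik] by rewrite EJ mem_head.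
  by rewrite mem_filter => /andP[? /JK].
rewrite /top /= => topik.
have rcv u : agree u -> received P (marks_first u) h (remaining u) (mark i k (u i)).
  move=> uu0 x0; rewrite /marks_first marksE // EJ /= nth_index //.
  exact: top_mark_indep topik.
(* The preferred mark may also be a leftover of a known gadget; it is then the same item in all
   outcomes. *)
have [iS|iS] := boolP (i \in S); [by right; exists i, k|left].
exists i, (mark i k (u0 i)); split=> //; last first.
  by move=> u uu0; have /agreeP <- := uu0; last exact: iS; exact: rcv.
move: topik => /top_itemsP[]; rewrite (@mem_remaining _ i) /rest ?(negbTE iS) //.
by apply: gad_sub; exact: mark_gad.
Qed.

End Fresh.

(** Reindexing by [sigma] pairs each outcome with one of the opposite coin showing the same item.
    The decision is right for one and wrong for the other, so each pair contributes [1 + z]. *)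
Lemma marked_error_sum i k (z : R) (d : item I -> bool) : k \in keys ->
  \sum_(w : bool * T) z ^+ (d (mark i k w) != w.1) = #|T|%:R * (1 + z).
Proof.
move=> kK; have [sigma sigma_inj swap] := mark_swap i kK.
rewrite (eq_bigr (fun w => z ^+ (d (mark i k (w.1, w.2)) != w.1))); last by case.
rewrite -(pair_bigA _ (fun b t => z ^+ (d (mark i k (b, t)) != b))) /= big_bool /=.
have -> : \sum_t z ^+ (d (mark i k (false, t)) != false) =
    \sum_t z ^+ (d (mark i k (true, t)) != false).
  by rewrite [RHS](reindex_inj sigma_inj); apply: eq_bigr => t _; rewrite swap.
rewrite -big_split /=.
rewrite (eq_bigr (fun=> 1 + z)) => [|t _].
  by rewrite sumr_const cardT -cardE mulr_natl.
by case: (d _); rewrite /= ?expr0 ?expr1 // addrC.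
Qed.

Lemma wrong_first i w h x d h' :
  (forall y, y \in unzip1 h -> ~ U i y) -> U i x ->
  wrong i w (rcons h (x, d) ++ h') = (x \in [seq mark i k w | k <- keys]) && (d != w.1).
Proof.
move=> hU Ux; rewrite /wrong cat_rcons filter_cat.
rewrite (@eq_in_filter _ _ pred0) ?filter_pred0 /=.
  by rewrite (asboolT Ux).
by move=> e eh /=; apply/negP => /asboolP; apply/hU/map_f.
Qed.

(* The gadgets outside [S] are known, as some of their items have been received;
   those in [S] are still uniformly random. *)
Lemma error_potential (z : R) n (S : {set 'I_m}) (u0 : choice_of_gadgets)
    (r : 'I_m -> seq (item I)) (h : seq (item I * bool)) (a : seq bool) (t : tape) :
  0 <= z ->
  (forall i x, i \notin S -> x \in r i -> U i x) ->
  (forall y, y \in unzip1 h -> universe U y) ->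
  (forall i y, i \in S -> y \in unzip1 h -> ~ U i y) ->
  (forall u, (size (remaining S r u) <= n)%N) ->
  \sum_(u | agree S u0 u)
     z ^+ (\sum_(i in S) wrong i (u i)
            (run_from A (marks_first u) (size (remaining S r u)) (remaining S r u) h a t).1)
  <= (#|T|%:R * (1 + z)) ^+ #|S|.
Proof.
move=> z0.
have none_fresh (v : choice_of_gadgets) (F : choice_of_gadgets -> 'I_m -> nat) (c : R) :
    \sum_(u | agree finset.set0 v u) z ^+ (\sum_(i in finset.set0) F u i) <=
    c ^+ #|@finset.set0 'I_m|.
  rewrite cards0 expr0 (big_pred1 v) ?big_set0 // => u.
  by apply/agreeP/eqP => [uv|-> //]; apply/ffunP => i; rewrite uv ?inE.
(* Induction on a bound for the number of remaining items. An empty [S] leaves a single outcome and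
   no errors to count; a nonempty one contradicts [n = 0]. *)
elim: n S u0 r h a t => [|n IH] S u0 r h a t r_sub h_univ h_fresh szn;
  (have [->|[i0 i0S]] := set_0Vmem S; first exact: none_fresh);
  have P_obl := oblA a h_univ;
  have X0 := remaining_nonempty r h_univ h_fresh P_obl u0 i0S.
  by have := szn u0; rewrite leqn0 size_eq0 (negbTE X0).
have [[i [x [iS xi rcv]]]|[i [k [iS kK rcv]]]] :=
    received_dichotomy r_sub h_univ h_fresh P_obl X0.
(* An item of a known gadget is received in every outcome: nothing is learnt and [S] is
   unchanged. *)
- pose r' j := if j == i then rem x (r i) else r j.
  have remE (u : choice_of_gadgets) : rem x (remaining S r u) = remaining S r' u.
    apply: (rem_bigcat (i := i)).
    + exact: index_enum_uniq.
    + exact: mem_index_enum.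
    + by rewrite /rest (negbTE iS).
    + move=> i' /eqP i'i; apply/negP => /(rest_sub r_sub) Ux.
      by apply: i'i; apply: (U_disjoint Ux); exact: r_sub xi.
    + by rewrite /rest /r' (negbTE iS) eqxx.
    + by move=> i' /negbTE i'i; rewrite /rest /r' i'i.
  have xX (u : choice_of_gadgets) : x \in remaining S r u.
    by apply/mem_bigcat_ord; exists i; rewrite /rest (negbTE iS).
  rewrite (eq_bigr (fun u : choice_of_gadgets => z ^+ (\sum_(j in S) wrong j (u j)
      (run_from A (marks_first u) (size (remaining S r' u)) (remaining S r' u)
        (rcons h (x, decision A h x (a ++ mkseq t (reading A h x a t))))
        (a ++ mkseq t (reading A h x a t))
        (fun j => t (reading A h x a t + j)%N)).1))); last first.
    move=> u uu0; by rewrite (run_from_size_step _ (xX u) (rcv u uu0)) remE.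
  apply: IH.
  + move=> j y jS; rewrite /r'; case: eqP => [->|_]; last exact: r_sub.
    by move=> /mem_rem; exact: r_sub.
  + move=> y; rewrite /unzip1 map_rcons mem_rcons inE => /predU1P[->|]; last exact: h_univ.
    by exists i => //; exact: r_sub xi.
  + move=> j y jS; rewrite /unzip1 map_rcons mem_rcons inE => /predU1P[->|]; last exact: h_fresh.
    move=> Ujx; have ij := U_disjoint Ujx (r_sub _ _ iS xi).
    by rewrite ij (negbTE iS) in jS.
  + move=> u; rewrite -remE size_rem //.
    by have := szn u; case: (remaining S r u).
(* With tape and history fixed, the decision is a function of the received item alone. Splitting by
   the value [w] of [u i] turns the factor at [i] into a [marked_error_sum]. *)
pose d x := decision A h x (a ++ mkseq t (reading A h x a t)).
rewrite (partition_big (fun u : choice_of_gadgets => u i) predT) //=.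
rewrite (cardsD1 i) iS exprS -{1}(marked_error_sum i z d kK) mulr_suml.
apply: ler_sum => w _.
pose x := mark i k w.
have Ux : U i x by apply: (@gad_sub _ w); exact: mark_gad.
pose r' j := if j == i then rem x (gad i w) else r j.
pose u0' : choice_of_gadgets := [ffun j => if j == i then w else u0 j].
have remE (u : choice_of_gadgets) : u i = w -> rem x (remaining S r u) = remaining (S :\ i) r' u.
  move=> uiw; apply: (rem_bigcat (i := i)).
  + exact: index_enum_uniq.
  + exact: mem_index_enum.
  + by rewrite /rest iS uiw mark_gad.
  + move=> i' /eqP i'i; apply/negP => /(rest_sub r_sub) Ui'x.
    by apply: i'i; apply: (U_disjoint Ui'x).
  + by rewrite /rest /r' iS eqxx !inE eqxx uiw.
  + by move=> i' i'i; rewrite /rest /r' !inE i'i (negbTE i'i).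
have xX (u : choice_of_gadgets) : u i = w -> x \in remaining S r u.
  by move=> uiw; apply/mem_bigcat_ord; exists i; rewrite /rest iS uiw mark_gad.
(* Conditioning on [u i = w] moves [i] to the known subuniverses. *)
rewrite (eq_bigl (agree (S :\ i) u0')); last first.
  move=> u; apply/andP/agreeP => [[/agreeP uu0 /eqP uiw] j|uu0].
    by rewrite !inE negb_and negbK ffunE; case: eqP => [-> //|_ /= /uu0].
  split; last by rewrite uu0 ?ffunE ?eqxx // !inE eqxx.
  apply/agreeP => j jS; rewrite uu0; last by rewrite !inE negb_and jS orbT.
  by rewrite ffunE ifN //; apply: contraNneq jS => ->.
(* The error at [i] is settled by the decision just made, so its factor leaves the sum. *)
rewrite (eq_bigr (fun u : choice_of_gadgets => z ^+ (d x != w.1) * z ^+ (\sum_(j in S :\ i) wrong j (u j)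
    (run_from A (marks_first u) (size (remaining (S :\ i) r' u)) (remaining (S :\ i) r' u) (rcons h (x, d x))
      (a ++ mkseq t (reading A h x a t))
      (fun j => t (reading A h x a t + j)%N)).1))); last first.
  move=> u uu0'; have uiw : u i = w.
    by have /agreeP -> := uu0'; rewrite ?ffunE ?eqxx // !inE eqxx.
  have uu0 : agree S u0 u.
    apply/agreeP => j jS; have /agreeP -> := uu0'; last by rewrite !inE negb_and jS orbT.
    by rewrite ffunE ifN //; apply: contraNneq jS => ->.
  have xr := rcv u uu0; rewrite uiw in xr.
  rewrite (run_from_size_step _ (xX u uiw) xr) remE // -/x -/(d x) -exprD; congr (z ^+ _).
  rewrite (big_setD1 i) //=; congr addn.
  have [h' ->] := run_from_prefix A (marks_first u) (size (remaining (S :\ i) r' u)) (remaining (S :\ i) r' u)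
    (rcons h (x, d x)) (a ++ mkseq t (reading A h x a t))
    (fun j => t (reading A h x a t + j)%N).
  by rewrite uiw wrong_first ?map_f // => y; exact: h_fresh.
rewrite -mulr_sumr ler_wpM2l ?exprn_ge0 //. apply: IH.
+ move=> j y; rewrite !inE negb_and negbK /r'; case: eqP => [-> _|_ /= jS].
    by move=> /mem_rem; exact: gad_sub.
  exact: r_sub.
+ move=> y; rewrite /unzip1 map_rcons mem_rcons inE => /predU1P[->|]; last exact: h_univ.
  by exists i.
+ move=> j y; rewrite !inE => /andP[ji jS].
  rewrite /unzip1 map_rcons mem_rcons inE => /predU1P[->|]; last exact: h_fresh.
  by move=> Ujx; rewrite (U_disjoint Ujx Ux) eqxx in ji.
(* The size bound is needed for every [u], but [remE] only covers [u i = w]; overwriting the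
   coordinate [i] leaves the remaining items unchanged. *)
+ move=> u; pose v : choice_of_gadgets := [ffun j => if j == i then w else u j].
  have viw : v i = w by rewrite ffunE eqxx.
  have -> : remaining (S :\ i) r' u = remaining (S :\ i) r' v.
    apply: eq_bigr => j _; rewrite /rest !inE.
    by have [->|ji] /= := eqVneq j i; rewrite ?ffunE ?(negbTE ji).
  rewrite -remE // size_rem ?xX //.
  by have := szn v; case: (remaining S r v).
Qed.

Definition gadget_instance (u : choice_of_gadgets) : seq (item I) :=
  \big[cat/[::]]_(i < m) gad i (u i).

(** Initially every subuniverse is fresh, and the bits read before the first item depend on the tape
    only. *)
Lemma run_error_potential (u0 : choice_of_gadgets) (z : R) t : 0 <= z ->
  \sum_(u : choice_of_gadgets)
     z ^+ (\sum_i wrong i (u i) (run A (marks_first u) (gadget_instance u) t).1)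
  <= (#|T|%:R * (1 + z)) ^+ m.
Proof.
move=> z0.
have E u : gadget_instance u = remaining [set: 'I_m] (fun=> [::]) u.
  by apply: eq_bigr => i _; rewrite /rest inE.
have := @error_potential z (\max_u size (gadget_instance u)) [set: 'I_m] u0
  (fun=> [::]) [::] (mkseq t (initial_reading A t))
  (fun i => t (initial_reading A t + i)%N) z0.
rewrite cardsT card_ord => H; apply: le_trans (H _ _ _ _) => //.
- rewrite le_eqVlt; apply/orP; left; apply/eqP; apply: eq_big.
    by move=> u; symmetry; apply/agreeP => i; rewrite inE.
  move=> u _; rewrite E; congr (z ^+ _); apply: eq_bigl => i.
  by rewrite inE.
- by move=> u; rewrite -E; apply: leq_bigmax.
Qed.

End RandomGadgets.

(** * Construction of the random gadgets *)

Section Construction.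
Variables (R : realType) (I : itemType) (n m : nat).
Variables (G : 'I_n -> bool -> pattern I).
Variables (N : 'I_m -> set (name I)) (U : 'I_m -> set (item I)).
Hypothesis G_first : forall j b, pattern_first (G j b) != [::] /\
  {subset pattern_first (G j b) <= pattern_items (G j b)}.
Hypothesis U_sub : forall i, subuniverse G (N i) (U i).
Hypothesis U_first : first_item_condition R G U.
Hypothesis U_copies : disjoint_copies_condition N U.

Lemma subuniverse_disjoint i i' x : U i x -> U i' x -> i = i'.
Proof.
move=> Ux U'x; apply/eqP/negPn/negP => /U_copies[_ UU _].
by have : (U i `&` U i')%classic x by []; rewrite UU.
Qed.

(** Some bijection carries one copy of [x] to the other and moves only names of these two copies.
    Those lie in [N i], which received items avoid, so the copies are indistinguishable. *)
Lemma oblivious_renaming i (s : seq (item I)) (P : item I -> R) f f' x :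
  (forall y, y \in s -> universe U y /\ ~ U i y) ->
  oblivious (universe U) s P -> bijective f -> bijective f' ->
  U i (rename f x) -> U i (rename f' x) -> P (rename f x) = P (rename f' x).
Proof.
move=> sU Pobl bf bf' Ufx Uf'x.
have [nU _ _] := U_sub i.
have [g fK gK] := bf.
have ginj : {in map f (names x) &, injective (f' \o g)}.
  by move=> a b _ _ /= /(bij_inj bf') /(can_inj gK).
have [p [bp pf pid]] := extend_partial_injection ginj.
apply: Pobl; [by exists i|by exists i|exists p; split=> //].
  move=> z a /sU[[i' _ Ui'z] nUiz] az.
  have [nU' _ _] := U_sub i'.
  have ii' : i != i' by apply: contra_notN nUiz => /eqP ->.
  have [NN _ _] := U_copies ii'.
  have Na : ~ N i a.
    move=> Nia; have Ni'a := nU' _ _ Ui'z az.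
    by have : (N i `&` N i')%classic a by []; rewrite NN.
  apply: pid; apply/negP.
    move=> afx; apply: Na; apply: (nU _ _ Ufx).
    by rewrite names_rename.
  move=> /mapP[_ /mapP[b bx ->]] /=; rewrite fK => ab; apply: Na.
  by apply: (nU _ _ Uf'x); rewrite names_rename // ab map_f.
rewrite -rename_comp //; apply: rename_eq => //; first exact: bij_comp.
by move=> a ax /=; rewrite pf ?map_f //= fK.
Qed.

Variables (j0 : 'I_n) (i0 : 'I_m).
Variables (f0 : bool -> name I -> name I) (g : 'I_m -> name I -> name I).
Hypothesis f0_bij : forall b, bijective (f0 b).
Hypothesis f0_over : forall b x a,
  x \in pattern_items (G j0 b) -> a \in names (rename (f0 b) x) -> N i0 a.
Hypothesis g_bij : forall i, bijective (g i).
Hypothesis g_copy : forall i x, U i0 x -> U i (rename (g i) x).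

Definition pattern_names b : seq (name I) :=
  flatten [seq map (f0 b) (names x) | x <- pattern_items (G j0 b)].

(** One pool for both patterns, so that a shuffle can carry an item of one pattern to its twin in
    the other. *)
Definition used_names : seq (name I) :=
  undup (pattern_names true ++ pattern_names false).

Local Notation shuffle := (perm_act (in_tuple used_names)).

(** The pattern is placed in the subuniverse [i0], shuffled within the pool, and carried over to the
    subuniverse [i]. *)
Definition embedding i (w : bool * 'S_(size used_names)) : name I -> name I :=
  g i \o (shuffle w.2 \o f0 w.1).

Definition gadget_copy i w : seq (item I) :=
  map (rename (embedding i w)) (pattern_items (G j0 w.1)).

(* The pairs of marked items that are the same item up to renaming, and hence
   leave open which of the two patterns they come from. *)
Definition twin_firsts : seq (item I * item I) :=
  [seq k <- [seq (x, y) | x <- pattern_first (G j0 true),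
                          y <- pattern_first (G j0 false)]
     | `[< exists2 q, bijective q & rename q k.1 = k.2 >]].

Definition marked_copy i (k : item I * item I) w : item I :=
  rename (embedding i w) (if w.1 then k.1 else k.2).

Lemma uniq_used : uniq (in_tuple used_names).
Proof. exact: undup_uniq. Qed.

Lemma mem_used b x a :
  x \in pattern_items (G j0 b) -> a \in names x -> f0 b a \in used_names.
Proof.
move=> xG ax; have fa : f0 b a \in pattern_names b.
  by apply/flattenP; exists (map (f0 b) (names x)); exact: map_f.
by rewrite mem_undup mem_cat; case: b fa {xG} => ->; rewrite ?orbT.
Qed.

Lemma used_sub a : a \in used_names -> N i0 a.
Proof.
have sub b : a \in pattern_names b -> N i0 a.
  move=> /flattenP[_ /mapP[x xG ->] afx].
  by apply: (f0_over xG); rewrite names_rename.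
by rewrite mem_undup mem_cat => /orP[]; exact: sub.
Qed.

Lemma shuffle_bij s : bijective (shuffle s).
Proof. exact/perm_act_bij/uniq_used. Qed.

Lemma embedding_bij i w : bijective (embedding i w).
Proof. by apply: bij_comp => //; apply: bij_comp => //; exact: shuffle_bij. Qed.

Lemma embedding_sub i w x :
  x \in pattern_items (G j0 w.1) -> U i (rename (embedding i w) x).
Proof.
move=> xG; have bsf : bijective (shuffle w.2 \o f0 w.1).
  by apply: bij_comp => //; exact: shuffle_bij.
rewrite rename_comp //; apply: g_copy.
have [_ + _] := U_sub i0; apply; [by []| |exact: xG] => y a yG.
rewrite names_rename // => /mapP[b by_ ->] /=; apply: used_sub.
by rewrite (perm_act_mem uniq_used) (mem_used yG).
Qed.

Lemma gadget_copyP i w : copy_in (U i) (G j0 w.1) (gadget_copy i w).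
Proof.
split; first by exists (embedding i w); split; [exact: embedding_bij|].
by move=> _ /mapP[x xG ->]; exact: embedding_sub.
Qed.

Lemma twin_firstsP k : k \in twin_firsts ->
  [/\ k.1 \in pattern_first (G j0 true), k.2 \in pattern_first (G j0 false)
    & exists2 q, bijective q & rename q k.1 = k.2].
Proof.
by rewrite mem_filter andbC => /andP[/allpairsP[[x y] [? ? ->]] /asboolP].
Qed.

Lemma marked_copyP i k w : k \in twin_firsts ->
  first_copy_in (U i) (G j0 w.1) (marked_copy i k w) (gadget_copy i w).
Proof.
move=> /twin_firstsP[k1 k2 _]; split; last by have [] := gadget_copyP i w.
exists (embedding i w); first by split; [exact: embedding_bij|].
by apply: map_f; case: w => -[] t.
Qed.

(** A shuffle [s] realizes, on the names of the first twin, the renaming [q] to the second; [sigma]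
    is multiplication by [s]. *)
Lemma marked_copy_swap i k : k \in twin_firsts ->
  exists2 sigma : 'S_(size used_names) -> 'S_(size used_names), injective sigma
    & forall t, marked_copy i k (false, t) = marked_copy i k (true, sigma t).
Proof.
case: k => x y /twin_firstsP[/= xG yG [q bq qxy]].
have xG' := (G_first j0 true).2 _ xG; have yG' := (G_first j0 false).2 _ yG.
have [f1 f0K f1K] := f0_bij true.
have [|||s hs] := @perm_act_extend _ _ _ uniq_used (map (f0 true) (names x))
  (f0 false \o (q \o f1)).
- by move=> a b _ _ /= /(bij_inj (f0_bij false)) /(bij_inj bq) /(can_inj f1K).
- by move=> _ /mapP[a ax ->]; exact: (mem_used xG').
- move=> _ /mapP[_ /mapP[a ax ->] ->] /=; rewrite f0K.
  by apply: (mem_used yG'); rewrite -qxy names_rename // map_f.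
(* In the product [s * t] the factor [s] acts first. *)
exists (mulg s); first exact: mulgI.
move=> t; rewrite /marked_copy /= -qxy -rename_comp //; last exact: embedding_bij.
apply: rename_eq; [|exact: embedding_bij|].
  by apply: bij_comp => //; exact: embedding_bij.
move=> a ax; rewrite /embedding /= (perm_actM uniq_used) hs ?map_f //=.
by rewrite f0K.
Qed.

Lemma marked_copy_priority i (s : seq (item I)) (P : item I -> R) :
  (forall y, y \in s -> universe U y /\ ~ U i y) -> oblivious (universe U) s P ->
  {in twin_firsts, forall k w w', P (marked_copy i k w) = P (marked_copy i k w')} /\
  exists2 k, k \in twin_firsts
    & forall w w' y, y \in gadget_copy i w -> P y <= P (marked_copy i k w').
Proof.
move=> sU Pobl; split.
  move=> k kK w w'; have [_ _ [q bq qk]] := twin_firstsP kK.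
  have mE v : exists2 f, bijective f & marked_copy i k v = rename f k.1.
    rewrite /marked_copy; case: ifP => _.
      by exists (embedding i v) => //; exact: embedding_bij.
    exists (embedding i v \o q); first by apply: bij_comp => //; exact: embedding_bij.
    by rewrite rename_comp ?qk //; exact: embedding_bij.
  have mU v : U i (marked_copy i k v).
    have [[f [bf pf] mf]] := marked_copyP i v kK; apply.
    rewrite (perm_mem pf); case/mapP: mf => z zG ->; apply: map_f.
    exact: (G_first _ _).2 _ zG.
  move: (mU w) (mU w').
  by have [f bf ->] := mE w; have [f' bf' ->] := mE w'; exact: (oblivious_renaming sU Pobl bf bf').
have X0 : gadget_copy i (true, 1%g) != [::].
  have [+ sub] := G_first j0 true; case E: (pattern_first _) => [//|z Z] _.
  have : z \in pattern_items (G j0 true) by apply: sub; rewrite E mem_head.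
  by rewrite /gadget_copy /=; case: (pattern_items _).
have [x xtop] := exists_highest P X0.
(* The top item [x] of one copy is a marked, top item in copies of both patterns; its two preimages
   form the dominating key. *)
have [pair /(_ i s P j0 true _ x sU Pobl (gadget_copyP i (true, 1%g)) xtop) [_ copies]] := U_first.
have [X1 [[f1 [bf1 pf1] /mapP[y1 y1G xy1]] U1] top1] := copies true.
have [X2 [[f2 [bf2 pf2] /mapP[y2 y2G xy2]] U2] top2] := copies false.
have kK : (y1, y2) \in twin_firsts.
  rewrite mem_filter; apply/andP; split; last by apply/allpairsP; exists (y1, y2).
  apply/asboolP; have [f2' f2K f2'K] := bf2.
  have bf2' : bijective f2' by exists f2.
  exists (f2' \o f1) => /=; first exact: bij_comp.
  rewrite rename_comp // -xy1 xy2 -rename_comp // -[RHS](rename_id y2).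
  by apply: rename_eq; [exact: bij_comp|exists id|move=> a _ /=].
exists (y1, y2) => // w w' y.
have Px v : P (marked_copy i (y1, y2) v) = P x.
  have UM : U i (marked_copy i (y1, y2) v).
    have [[f [bf pf] mf]] := marked_copyP i v kK; apply.
    rewrite (perm_mem pf); case/mapP: mf => z zG ->; apply: map_f.
    exact: (G_first _ _).2 _ zG.
  have Ux : U i x by apply: U1; case: top1.
  rewrite /marked_copy in UM *; case: ifP UM => _ UM.
    by rewrite xy1 in Ux *; apply: (oblivious_renaming sU) => //; exact: embedding_bij.
  by rewrite xy2 in Ux *; apply: (oblivious_renaming sU) => //; exact: embedding_bij.
rewrite Px => /mapP[z zG ->].
(* [X1] or [X2] contains a copy of [z], dominated there by [x]; all copies of [z] in [U i] have the
   same priority. *)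
have [f bf [fzU fzx]] : exists2 f, bijective f & U i (rename f z) /\ P (rename f z) <= P x.
  case: w zG => -[] t /= zG.
    exists f1 => //; have fz : rename f1 z \in X1 by rewrite (perm_mem pf1) map_f.
    by split; [exact: U1|exact: top1.2].
  exists f2 => //; have fz : rename f2 z \in X2 by rewrite (perm_mem pf2) map_f.
  by split; [exact: U2|exact: top2.2].
apply: le_trans fzx; rewrite le_eqVlt; apply/orP; left; apply/eqP.
by apply: (oblivious_renaming sU) => //; [exact: embedding_bij|exact: embedding_sub].
Qed.

End Construction.

(** * Counting errors over all tapes *)

(** Take logarithms: since [1 + z] is the inverse of [1 - eps], the terms in [ln eps] and
    [ln (1 - eps)] combine to the entropy. *)
Lemma entropy_bound (R : realType) (eps : R) (m C : nat) (z := eps / (1 - eps)) :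
  0 < eps -> eps <= 1 / 2 ->
  z `^ (eps * m%:R) <= 2 ^+ C * ((1 + z) / 2) ^+ m ->
  (1 - binary_entropy eps) * m%:R <= C%:R.
Proof.
move=> e0 e2 le_z; have e1 : 0 < 1 - eps by lra.
have z0 : 0 < z by rewrite divr_gt0.
have l2 : 0 < ln (2 : R) by rewrite ln_gt0 // ltr1n.
have z1 : 0 < 1 + z by rewrite addr_gt0.
have zE : 1 + z = (1 - eps)^-1 by rewrite /z; field; lra.
have zd : z = eps / (1 - eps) by [].
clearbody z; have := le_z; rewrite -ler_ln ?posrE ?powR_gt0 ?mulr_gt0 ?exprn_gt0 ?divr_gt0 //.
rewrite ln_powR lnM ?posrE ?exprn_gt0 ?divr_gt0 //.
have lnz : ln ((1 + z) / 2) = - ln (1 - eps) - ln 2.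
  by rewrite ln_div ?posrE // zE lnV ?posrE.
rewrite !lnXn ?divr_gt0 // lnz zd ln_div ?posrE // /binary_entropy.
set a := ln eps; set b := ln (1 - eps); set l := ln 2; rewrite -[l *+ C]mulr_natl -[(_ - l) *+ m]mulr_natl => H.
rewrite -(ler_pM2r l2) -/l.
have -> : (1 - (- eps * (a / l) - (1 - eps) * (b / l))) * m%:R * l =
    m%:R * (l + eps * a + (1 - eps) * b) by field; rewrite gt_eqF.
by lra.
Qed.

(** The excess cost is [(c - 1) * E], with [E] the optimal value of the wrong part. The share of [E]
    in the total is least when wrong gadgets have value [a], the others [r], and exactly a fraction
    [eps] is wrong. *)
Lemma ratio_bound (R : realFieldType) (m : nat) (W : pred 'I_m) (v : 'I_m -> R)
    (a r eps c : R) :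
  (0 < m)%N -> 0 < a -> a <= r -> 0 < eps -> eps <= 1 / 2 -> 1 <= c ->
  (forall i, a <= v i <= r) -> eps * m%:R <= (\sum_i W i)%N%:R ->
  (1 + eps * (c - 1) * a / (eps * a + (1 - eps) * r)) * (\sum_i v i) <=
    \sum_i (if W i then c * v i else v i).
Proof.
move=> m0 a0 ar e0 e2 c1 av eW.
have e1 : 0 < 1 - eps by lra.
have r0 : 0 < r by lra.
pose E := \sum_(i | W i) v i; pose F := \sum_(i | ~~ W i) v i.
have vE : \sum_i v i = E + F by rewrite (bigID W).
have -> : \sum_i (if W i then c * v i else v i) = c * E + F.
  rewrite (bigID W) /= mulr_sumr; congr (_ + _); apply: eq_bigr => i.
    by move=> ->.
  by move/negbTE => ->.
pose e := (\sum_i W i)%N.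
have eE : e%:R = \sum_(i | W i) (1 : R).
  by rewrite /e natr_sum [RHS]big_mkcond; apply: eq_bigr => i _; case: (W i).
have fE : m%:R - e%:R = \sum_(i | ~~ W i) (1 : R).
  have -> : m%:R = \sum_(i < m) (1 : R) by rewrite sumr_const card_ord.
  by rewrite (bigID W) /= -eE addrAC subrr add0r.
have Ea : e%:R * a <= E.
  by rewrite eE mulr_suml; apply: ler_sum => i _; rewrite mul1r; case/andP: (av i).
have Fr : F <= (m%:R - e%:R) * r.
  by rewrite fE mulr_suml; apply: ler_sum => i _; rewrite mul1r; case/andP: (av i).
rewrite -/e in eW; rewrite vE.
set D := eps * a + _.
have D0 : 0 < D by rewrite addr_gt0 // mulr_gt0.
have key : eps * a * (E + F) <= E * D.
  have E1 : eps * m%:R * a <= E by apply: le_trans Ea; rewrite ler_pM2r.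
  have F1 : F <= (1 - eps) * m%:R * r.
    by apply: le_trans Fr _; rewrite ler_pM2r //; lra.
  have E2 : eps * m%:R * a * ((1 - eps) * r) <= E * ((1 - eps) * r).
    by rewrite ler_pM2r // mulr_gt0.
  have F2 : eps * a * F <= eps * a * ((1 - eps) * m%:R * r).
    by rewrite ler_pM2l // mulr_gt0.
  by rewrite /D; lra.
have -> : (1 + eps * (c - 1) * a / D) * (E + F) =
    (E + F) + (c - 1) * (eps * a * (E + F) / D) by field; rewrite gt_eqF.
have : (c - 1) * (eps * a * (E + F) / D) <= (c - 1) * E.
  by rewrite ler_wpM2l ?subr_ge0 // ler_pdivrMr.
by lra.
Qed.

(* [z = eps / (1 - eps)] is the optimal choice in the Chernoff bound. *)
Lemma many_errors (R : realType) (Omega V : finType) (e : V -> Omega -> nat)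
    (eps : R) (m C tau : nat) (z := eps / (1 - eps)) :
  0 < eps -> eps <= 1 / 2 -> (0 < tau)%N ->
  #|Omega| = ((2 * tau) ^ m)%N -> #|V| = (2 ^ C)%N ->
  (forall v, \sum_u z ^+ e v u <= (tau%:R * (1 + z)) ^+ m) ->
  C%:R < (1 - binary_entropy eps) * m%:R ->
  exists u, forall v, eps * m%:R <= (e v u)%:R.
Proof.
move=> e0 e2 tau0 cardO cardV bound; apply: contraPP => /forallNP few.
apply/negP; rewrite -leNgt; apply: entropy_bound => //; rewrite -/z.
have e1 : 0 < 1 - eps by lra.
have z0 : 0 < z by rewrite divr_gt0.
(* This is where [eps <= 1 / 2] enters: powers of [z] decrease in the exponent. *)
have z1 : z <= 1 by rewrite ler_pdivrMr //; lra.
clearbody z; have tauR : 0 < (2 * tau%:R : R) ^+ m by rewrite exprn_gt0 // mulr_gt0 ?ltr0n.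
rewrite -(ler_pM2l tauR).
have -> : (2 * tau%:R) ^+ m * (2 ^+ C * ((1 + z) / 2) ^+ m) =
    2 ^+ C * (tau%:R * (1 + z)) ^+ m.
  by rewrite mulrCA -exprMn; congr (_ * _ ^+ _); field.
have -> : (2 * tau%:R) ^+ m * z `^ (eps * m%:R) = \sum_(u : Omega) z `^ (eps * m%:R).
  by rewrite sumr_const cardO -[RHS]mulr_natl natrX natrM.
have -> : 2 ^+ C * (tau%:R * (1 + z)) ^+ m = \sum_(v : V) (tau%:R * (1 + z)) ^+ m.
  by rewrite sumr_const cardV -[RHS]mulr_natl natrX.
apply: (@le_trans _ _ (\sum_v \sum_u z ^+ e v u)); last exact: ler_sum.
rewrite exchange_big; apply: ler_sum => u _.
(* A single word [v] with few errors on [u] already contributes at least [z] to the power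
   [eps * m]. *)
have [v /negP] := (existsNP _).2 (few u); rewrite -ltNge => evu.
rewrite (bigD1 v) //= -[leLHS]addr0 lerD //.
  by rewrite -(powR_mulrn _ (ltW z0)) ger_powR ?z0 // ltW.
by apply: sumr_ge0 => v' _; rewrite exprn_ge0 // ltW.
Qed.

(** * Costs of wrong first decisions *)

Section Objective.
Variables (R : realType) (I : itemType) (B : problem R I).

Lemma OPT_le (D : seq (item I * bool)) : (OPT B (unzip1 D) <= objective B D)%E.
Proof.
have sD : size (unzip2 D) == size (unzip1 D) by rewrite !size_map.
rewrite -{2}(zip_unzip D).
exact: (bigmin_le _ (Tuple sD) (fun d => objective B (zip (unzip1 D) (val d)))).
Qed.

Lemma OPT_attained X : exists2 D, unzip1 D = X & objective B D = OPT B X.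
Proof.
(* The constant tuple shows that there are decisions to minimize over, so the minimum is attained by
   one of them. *)
have [//||d _ dE] := @eq_bigmin _ _ _ +oo%E (nseq_tuple (size X) true) predT
  (fun d : (size X).-tuple bool => objective B (zip X d)).
  by move=> d _; exact: leey.
by exists (zip X d); [rewrite unzip1_zip ?size_tuple|exact/esym/dE].
Qed.

Lemma BAD_le x d (D : seq (item I * bool)) :
  ~~ optimal_decision B (unzip1 ((x, d) :: D)) x d ->
  (BAD B (unzip1 ((x, d) :: D)) x <= objective B ((x, d) :: D))%E.
Proof.
move=> nopt; apply: le_trans.
  exact: (bigmin_le_cond _ (P := fun d => ~~ _) _ nopt).
have remE : rem x (unzip1 ((x, d) :: D)) = unzip1 D by rewrite /= eqxx.
have sD : size (unzip2 D) == size (rem x (unzip1 ((x, d) :: D))).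
  by rewrite remE !size_map.
rewrite -{2}(zip_unzip D) -remE.
exact: (bigmin_le _ (Tuple sD)
  (fun e => objective B ((x, d) :: zip (rem x (unzip1 ((x, d) :: D))) (val e)))).
Qed.

Lemma best_after_ge (X : seq (item I)) x d : x \in X -> (OPT B X <= best_after B X x d)%E.
Proof.
move=> xX; have [//||e _ eE] := @eq_bigmin _ _ _ +oo%E (nseq_tuple (size (rem x X)) true)
  predT (fun e : (size (rem x X)).-tuple bool => objective B ((x, d) :: zip (rem x X) e)).
  by move=> e _; exact: leey.
have -> : best_after B X x d = objective B ((x, d) :: zip (rem x X) e) := eE.
set D := _ :: _.
have pD : perm_eq X (unzip1 D).
  by rewrite /= unzip1_zip ?size_tuple //; exact: perm_to_rem.
clearbody D.
(* [best_after] puts [x] in front, while [OPT] keeps the order of [X]; the decided items are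
   permuted back, which the objective ignores. *)
have [D' uD' <-] : exists2 D', unzip1 D' = X & objective B D' = objective B D.
  have szD : size (unzip1 D) = size D by rewrite size_map.
  have /(perm_iotaP x)[s ps Xs] := pD.
  exists [seq nth (x, d) D i | i <- s].
    rewrite Xs /unzip1 -map_comp; apply/eq_in_map => i.
    rewrite (perm_mem ps) mem_iota add0n szD => /= iD.
    by rewrite (nth_map (x, d)).
  apply: objective_perm; rewrite -{2}(mkseq_nth (x, d) D) /mkseq.
  by apply: perm_map; rewrite -szD.
by rewrite -{1}uD'; exact: OPT_le.
Qed.

Lemma BAD_ge_OPT (X : seq (item I)) x : x \in X -> (OPT B X <= BAD B X x)%E.
Proof.
by move=> xX; apply: le_bigmin; [exact: leey|move=> d _; exact: best_after_ge].
Qed.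

End Objective.

(** * Splitting costs and optimal values over the subuniverses *)

Section GadgetCosts.
Variables (R : realType) (I : itemType) (B : problem R I).
Variables (n m : nat) (G : 'I_n -> bool -> pattern I) (U : 'I_m -> set (item I)).
Hypothesis B_additive : additive_wrt_gadgets B G U.
Hypothesis G_distinguishing : distinguishing_decision_condition B G U.
Hypothesis U_disjoint : forall i i' x, U i x -> U i' x -> i = i'.

Variables (j0 : 'I_n) (OPTv : bool -> R) (BADv : bool -> \bar R).
Hypothesis G_OPT : forall b, pattern_OPT B U (G j0 b) (OPTv b)%:E.
Hypothesis G_BAD : forall b, pattern_BAD B U (G j0 b) (BADv b).

Variables (T : finType) (K : eqType) (keys : seq K).
Variables (gad : 'I_m -> bool * T -> seq (item I)).
Variables (mark : 'I_m -> K -> bool * T -> item I).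
Hypothesis gadP : forall i w, copy_in (U i) (G j0 w.1) (gad i w).
Hypothesis markP : forall i k w, k \in keys ->
  first_copy_in (U i) (G j0 w.1) (mark i k w) (gad i w).

Definition part (i : 'I_m) (H : seq (item I * bool)) : seq (item I * bool) :=
  [seq e <- H | `[< U i e.1 >]].

Variable (u : {ffun 'I_m -> bool * T}).
Local Notation X := (gadget_instance gad u).

Lemma part_copy i H :
  perm_eq (unzip1 H) X -> perm_eq (unzip1 (part i H)) (gad i (u i)).
Proof.
move=> HX.
have -> : unzip1 (part i H) = [seq x <- unzip1 H | `[< U i x >]].
  by rewrite /unzip1 filter_map.
have -> : gad i (u i) = [seq x <- X | `[< U i x >]]; last exact: perm_filter.
rewrite filter_bigcat -[LHS](@big_pred1_eq _ [::] cat _ i (fun i => gad i (u i))) big_mkcond.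
apply: eq_bigr => i' _; case: eqP => [->|/eqP ii'].
  rewrite (@eq_in_filter _ _ predT) ?filter_predT // => x xi.
  by apply/asboolP; have [_] := gadP i (u i); apply.
rewrite (@eq_in_filter _ _ pred0) ?filter_pred0 // => x xi.
apply/negP => /asboolP Ux; have [_ /(_ _ xi) U'x] := gadP i' (u i').
by rewrite (U_disjoint U'x Ux) eqxx in ii'.
Qed.

Lemma perm_parts H :
  perm_eq (unzip1 H) X -> perm_eq H (\big[cat/[::]]_(i < m) part i H).
Proof.
move=> HX; apply/seq.permP => a.
rewrite (big_morph (count a) (id1 := 0%N) (op1 := addn)) //; last exact: count_cat.
under eq_bigr => i _ do rewrite count_filter -sum1_count big_mkcond /=.
rewrite exchange_big /= -sum1_count big_mkcond /=; apply: eq_big_seq => e eH.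
have : e.1 \in X by rewrite -(perm_mem HX) map_f.
case/mem_bigcat_ord => i ei; have [_ /(_ _ ei) Ui] := gadP i (u i).
rewrite -(@big_pred1_eq _ 0%N addn _ i (fun=> if a e then 1%N else 0%N)) big_mkcond /=.
apply: eq_bigr => i' _; case: eqP => [->|ii']; first by rewrite (asboolT Ui) andbT.
by rewrite asboolF ?andbF // => U'e; apply: ii'; exact: U_disjoint U'e Ui.
Qed.

Lemma objective_bigcat (D : 'I_m -> seq (item I * bool)) :
  (forall i, gadget_in G (U i) (unzip1 (D i))) ->
  objective B (\big[cat/[::]]_(i < m) D i) = (\sum_(i < m) objective B (D i))%E.
Proof.
have allE (V : Type) (v : V) op F :
    \big[op/v]_(i in [set: 'I_m]) F i = \big[op/v]_(i < m) F i.
  by apply: eq_bigl => i; rewrite inE.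
by move=> DG; have := @B_additive [set: 'I_m] D (fun i _ => DG i); rewrite !allE.
Qed.

Lemma objective_parts H : perm_eq (unzip1 H) X ->
  objective B H = (\sum_(i < m) objective B (part i H))%E.
Proof.
move=> HX; rewrite (objective_perm B (perm_parts HX)).
apply: objective_bigcat => i; exists j0, (u i).1; have [[f [bf pf]] sub] := gadP i (u i).
split; first by exists f; split=> //; exact: perm_trans (part_copy i HX) pf.
by move=> x; rewrite (perm_mem (part_copy i HX)); exact: sub.
Qed.

Lemma part_OPT i H : perm_eq (unzip1 H) X ->
  ((OPTv (u i).1)%:E <= objective B (part i H))%E.
Proof.
move=> HX; have <- : OPT B (unzip1 (part i H)) = (OPTv (u i).1)%:E; last exact: OPT_le.
apply: (@G_OPT _ i); have [[f [bf pf]] sub] := gadP i (u i).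
split; first by exists f; split=> //; exact: perm_trans (part_copy i HX) pf.
by move=> x; rewrite (perm_mem (part_copy i HX)); exact: sub.
Qed.

(** The head of [part i H] is the decision inspected by [wrong]. The distinguishing condition makes
    it non-optimal, and the rest of the part is one of the completions over which [BAD]
    minimizes. *)
Lemma part_BAD i H : perm_eq (unzip1 H) X -> wrong U keys mark i (u i) H ->
  (BADv (u i).1 <= objective B (part i H))%E.
Proof.
move=> HX; rewrite /wrong -/(part i H).
have pX := part_copy i HX; case E: (part i H) pX => [//|[x d] D] pX /=.
move=> /andP[/mapP[k kK xk] dw].
have fc : first_copy_in (U i) (G j0 (u i).1) x (unzip1 ((x, d) :: D)).
  have [[f [bf pf] mf] sub] := markP i (u i) kK; rewrite -xk in mf.
  split; first by exists f => //; split=> //; exact: perm_trans pX pf.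
  by move=> y; rewrite (perm_mem pX); exact: sub.
by rewrite -(G_BAD fc); apply: BAD_le; rewrite (G_distinguishing fc).
Qed.

Lemma objective_ge H : perm_eq (unzip1 H) X ->
  (\sum_(i < m) (if wrong U keys mark i (u i) H
                 then BADv (u i).1 else (OPTv (u i).1)%:E) <= objective B H)%E.
Proof.
move=> HX; rewrite (objective_parts HX); apply: lee_sum => i _.
by case: ifP => [/(part_BAD HX)//|_]; exact: part_OPT.
Qed.

(** An optimal solution restricts to each gadget, and optimal solutions of the gadgets
    concatenate. *)
Lemma OPT_instance : OPT B X = (\sum_(i < m) OPTv (u i).1)%:E.
Proof.
rewrite -sumEFin; apply/eqP; rewrite eq_le; apply/andP; split; last first.
  have [D uD <-] := OPT_attained B X.
  have DX : perm_eq (unzip1 D) X by rewrite uD.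
  by rewrite (objective_parts DX); apply: lee_sum => i _; exact: part_OPT.
have /all_sig2[D uD oD] i : {D | unzip1 D = gad i (u i) & objective B D = OPT B (gad i (u i))}.
  by apply: cid2; exact: OPT_attained.
have <- : unzip1 (\big[cat/[::]]_(i < m) D i) = X.
  by rewrite unzip1_bigcat; apply: eq_bigr.
apply: le_trans (OPT_le B _) _.
rewrite objective_bigcat; last by move=> i; rewrite uD; exists j0, (u i).1.
by apply: lee_sum => i _; rewrite oD (G_OPT (gadP i (u i))).
Qed.

(* [c] stands for rho, which may be infinite. *)
Lemma cost_ratio_ge H (eps a r c : R) :
  (0 < m)%N -> 0 < a -> a <= r -> 0 < eps -> eps <= 1 / 2 -> 1 <= c ->
  (forall b, a <= OPTv b <= r) -> (forall b, ((c * OPTv b)%:E <= BADv b)%E) ->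
  perm_eq (unzip1 H) X ->
  eps * m%:R <= (\sum_(i < m) wrong U keys mark i (u i) H)%N%:R ->
  ((1 + eps * (c - 1) * a / (eps * a + (1 - eps) * r))%:E <=
     objective B H / OPT B X)%E.
Proof.
move=> m0 a0 ar e0 e2 c1 aOPT cBAD HX many.
have sum0 : 0 < \sum_(i < m) OPTv (u i).1.
  rewrite (bigD1 (Ordinal m0)) //= ltr_wpDr //.
    by apply: sumr_ge0 => i _; apply: le_trans (ltW a0) _; case/andP: (aOPT (u i).1).
  by apply: lt_le_trans a0 _; case/andP: (aOPT (u (Ordinal m0)).1).
rewrite OPT_instance inver gt_eqF // lee_pdivlMr // -EFinM.
apply: le_trans (objective_ge HX).
apply: (@le_trans _ _ (\sum_(i < m) (if wrong U keys mark i (u i) H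
    then c * OPTv (u i).1 else OPTv (u i).1)%:E)%E).
  rewrite sumEFin lee_fin.
  exact: (@ratio_bound _ _ (fun i => wrong U keys mark i (u i) H) (fun i => OPTv (u i).1)).
by apply: lee_sum => i _; case: ifP.
Qed.

End GadgetCosts.

Theorem theorem5 (R : realType) (I : itemType) (B : problem R I)
    (k m : nat) (G : 'I_k -> bool -> pattern I)
    (N : 'I_m -> set (name I)) (U : 'I_m -> set (item I))
    (OPTa OPTr : R) (BADa BADr : \bar R) (eps : R) :
  (1 <= k)%N ->
  (forall j b, gadget_pattern B (G j b)) ->
  (forall i, subuniverse G (N i) (U i)) ->
  additive_wrt_gadgets B G U ->
  consistency_condition B G U ->
  first_item_condition R G U ->
  distinguishing_decision_condition B G U ->
  disjoint_copies_condition N U ->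
  (forall j, pattern_OPT B U (G j accept) OPTa%:E) ->
  (forall j, pattern_BAD B U (G j accept) BADa) ->
  (forall j, pattern_OPT B U (G j reject) OPTr%:E) ->
  (forall j, pattern_BAD B U (G j reject) BADr) ->
  0 < OPTa -> OPTa <= OPTr ->
  0 < eps -> eps <= 1 / 2 ->
  let rho : \bar R := mine (BADa / OPTa%:E)%E (BADr / OPTr%:E)%E in
  let s : nat := max_items G in
  ~ exists (A : algorithm R I) (O : oracle I),
      [/\ oblivious_algorithm (universe U) A,
          (forall X tb, gadget_input B G U X -> legal_tie_break tb ->
             (advice_used A tb X (O X tb))%:R
               < (1 - binary_entropy eps) * (size X)%:R / s%:R)
        & (approximation_ratio B (gadget_input B G U) A O
             < 1 + (eps%:E * (rho - 1) * OPTa%:E)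
                   / (eps * OPTa + (1 - eps) * OPTr)%:E)%E].
Proof.
move=> k0 G_pattern U_sub B_add B_cons U_first G_dist U_copies OPTaP BADaP OPTrP BADrP.
move=> a0 ar e0 e2 rho s [A [oracleA [oblA advA ratioA]]].
have G_first j b : pattern_first (G j b) != [::] /\
    {subset pattern_first (G j b) <= pattern_items (G j b)}.
  by have [] := G_pattern j b.
have inputP (Y : 'I_m -> seq (item I)) : (forall i, gadget_in G (U i) (Y i)) ->
    gadget_input B G U (\big[cat/[::]]_(i < m) Y i).
  by move=> YG; split; [exact: B_cons|exists Y].
(* Without subuniverses the empty input is legal, and the strict advice bound asks for fewer than 0
   bits. *)
have [m0|m_gt0] := posnP m.
  have noYG i : gadget_in G (U i) [::] by case: i => i im; exfalso; move: im; rewrite m0.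
  have tb0 : legal_tie_break ((fun _ _ => 0%N) : tie_break I) by [].
  have := advA _ _ (inputP (fun=> [::]) noYG) tb0.
  by rewrite big1_eq /= mulr0 mul0r ltrn0.
pose j0 : 'I_k := Ordinal k0; pose i0 : 'I_m := Ordinal m_gt0.
have /all_sig2[f0 f0_bij f0_over] b : {f : name I -> name I | bijective f
    & forall x a, x \in pattern_items (G j0 b) -> a \in names (rename f x) -> N i0 a}.
  by apply: cid2; have [_ _] := U_sub i0; apply.
have /all_sig2[g g_bij g_copy] i : {g : name I -> name I | bijective g
    & forall x, U i0 x -> U i (rename g x)}.
  apply: cid2; have [<-|/U_copies[_ _ [f bf ->]]] := eqVneq i0 i.
    by exists id; [exists id|move=> x; rewrite rename_id].
  by exists f => // x Ux; exists x.
pose T := 'S_(size (used_names G j0 f0)).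
pose gad : 'I_m -> bool * T -> _ := gadget_copy (G := G) (j0 := j0) (f0 := f0) g.
pose mark : 'I_m -> _ -> bool * T -> _ := marked_copy (G := G) (j0 := j0) (f0 := f0) g.
pose keys := twin_firsts G j0.
have gadP i w : copy_in (U i) (G j0 w.1) (gad i w).
  exact: (gadget_copyP U_sub f0_bij f0_over g_bij g_copy).
have markP i x w : x \in keys -> first_copy_in (U i) (G j0 w.1) (mark i x w) (gad i w).
  exact: (marked_copyP U_sub f0_bij f0_over g_bij g_copy).
have gad_sub i w x : x \in gad i w -> U i x by have [_] := gadP i w; exact.
have mark_gad i x w : x \in keys -> mark i x w \in gad i w.
  move=> xK; have [[f [_ pf] /mapP[y yG ->]] _] := markP i x w xK.
  by rewrite (perm_mem pf); apply: map_f; have [_] := G_first j0 w.1; exact.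
have mark_swap := marked_copy_swap (j0 := j0) G_first f0_bij g_bij.
have mark_prio := marked_copy_priority G_first U_sub U_first U_copies f0_bij f0_over g_bij g_copy.
have U_disj := subuniverse_disjoint U_copies.
pose OPTv (b : bool) := if b then OPTa else OPTr.
pose BADv (b : bool) := if b then BADa else BADr.
have OPT_pos b : 0 < OPTv b by case: b => //; exact: lt_le_trans ar.
have G_OPT b : pattern_OPT B U (G j0 b) (OPTv b)%:E by case: b; [exact: OPTaP|exact: OPTrP].
have G_BAD b : pattern_BAD B U (G j0 b) (BADv b) by case: b; [exact: BADaP|exact: BADrP].
(* A constant priority is oblivious, so the first item condition provides a twin pair. *)
have [x0 x0K] : exists x, x \in keys.
  have [||_ [x xK _]] := mark_prio i0 [::] (fun=> 0) => //; by exists x.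
have OPT_BAD b : ((OPTv b)%:E <= BADv b)%E.
  have fc := markP i0 x0 (b, 1%g) x0K.
  rewrite -(G_BAD _ _ _ _ fc) -(G_OPT _ i0 _ (gadP i0 (b, 1%g))).
  by apply: BAD_ge_OPT; exact: mark_gad.
pose inst := gadget_instance gad.
have instP u : gadget_input B G U (inst u).
  by apply: inputP => i; exists j0, (u i).1.
pose tb := marks_first keys mark.
have tbP u : legal_tie_break (tb u) by exact: marks_first_legal.
pose advice u := oracleA (inst u) (tb u).
have s_gt0 : (0 < s)%N.
  apply: (@leq_trans (size (pattern_items (G j0 true)))).
    have [+ sub] := G_first j0 true; case E: (pattern_first _) => [//|x X] _.
    have : x \in pattern_items (G j0 true) by apply: sub; rewrite E mem_head.
    by case: (pattern_items _).
  by apply: leq_trans (leq_bigmax j0); exact: (leq_bigmax true).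
have size_inst u : (size (inst u) <= m * s)%N.
  have -> : (m * s = \sum_(i < m) s)%N by rewrite sum_nat_const card_ord.
  rewrite size_bigcat; apply: leq_sum => i _.
  rewrite size_map; apply: leq_trans (leq_bigmax j0).
  exact: (leq_bigmax (u i).1 (F := fun b => size (pattern_items (G j0 b)))).
have advice_small u : (advice_used A (tb u) (inst u) (advice u))%:R
    < (1 - binary_entropy eps) * m%:R.
  have H := advA _ _ (instP u) (tbP u); apply: lt_le_trans H _.
  (* A negative factor would make the strict advice bound unsatisfiable; a nonnegative one preserves
     the inequality [n / s <= m]. *)
  have [He|/ltW He] := leP 0 (1 - binary_entropy eps); last first.
    exfalso; have := advA _ _ (instP u) (tbP u); apply/negP; rewrite -leNgt.
    by apply: le_trans (ler0n _ _); rewrite -mulrA mulr_le0_ge0 // divr_ge0.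
  rewrite -mulrA ler_wpM2l // ler_pdivrMr ?ltr0n // -natrM ler_nat.
  exact: size_inst.
pose C := (\max_u advice_used A (tb u) (inst u) (advice u))%N.
have C_small : C%:R < (1 - binary_entropy eps) * m%:R.
  have [//|u _ uC] := @eq_bigmax_cond _ predT
    (fun u => advice_used A (tb u) (inst u) (advice u)).
    by apply/card_gt0P; exists [ffun=> (true, 1%g)].
  by rewrite /C uC; exact: advice_small.
pose tape_of (v : C.-tuple bool) : tape := nth false v.
pose errors (v : C.-tuple bool) (u : {ffun 'I_m -> bool * T}) : nat :=
  (\sum_(i < m) wrong U keys mark i (u i) (run A (tb u) (inst u) (tape_of v)).1)%N.
(* One [u] defeats all words of length [C] at once, hence also the beginning of the tape that the
   oracle writes for this very [u]. *)
have [u many] : exists u, forall v, eps * m%:R <= (errors v u)%:R.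
  apply: (many_errors (m := m) (C := C) (tau := #|{: T}|)) => //.
  - by apply/card_gt0P; exists 1%g.
  - by rewrite card_ffun card_ord card_prod card_bool.
  - by rewrite card_tuple card_bool.
  - move=> v; have z0 : 0 <= eps / (1 - eps) by rewrite divr_ge0 //; lra.
    have := run_error_potential U_disj gad_sub mark_gad mark_swap mark_prio oblA
      [ffun=> (true, 1%g)] (tape_of v) z0.
    exact.
have [v runE] : exists v, run A (tb u) (inst u) (tape_of v) =
    run A (tb u) (inst u) (advice u).
  exists [tuple advice u i | i < C].
  have uC : (advice_used A (tb u) (inst u) (advice u) <= C)%N.
    exact: (leq_bigmax u (F := fun u => advice_used A (tb u) (inst u) (advice u))).
  apply: run_truncate (tbP u) uC _.
  by move=> i iC; rewrite /tape_of (nth_mktuple _ _ (Ordinal iC)).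
have many' := many v; rewrite /errors runE in many'.
set H := (run A (tb u) (inst u) (advice u)).1 in many'.
have HX : perm_eq (unzip1 H) (inst u) by exact: (run_from_perm _ _ _ _ (tbP u)).
pose D := eps * OPTa + (1 - eps) * OPTr.
have D0 : 0 < D.
  by rewrite addr_gt0 // mulr_gt0 //; [lra|exact: lt_le_trans ar].
(* Stated for finite [c] below [rho], because [rho] itself is infinite when both [BADa] and [BADr]
   are. *)
have ratio_ge c : 1 <= c -> (c%:E <= rho)%E ->
    ((1 + eps * (c - 1) * OPTa / D)%:E <=
       approximation_ratio B (gadget_input B G U) A oracleA)%E.
  move=> c1; rewrite le_min !inver !gt_eqF //; last exact: (OPT_pos false).
  rewrite !lee_pdivlMr //; last exact: (OPT_pos false).
  move=> /andP[ca cr]; apply: (@le_trans _ _ (objective B H / OPT B (inst u))%E).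
    apply: (cost_ratio_ge B_add G_dist U_disj G_OPT G_BAD gadP markP) => //.
    - by case=> /=; rewrite ?lexx ?ar.
    - by case; rewrite EFinM.
  by apply: ereal_sup_ubound; exists (inst u), (tb u); split.
have rho1 : (1%:E <= rho)%E.
  rewrite le_min !inver !gt_eqF //; last exact: (OPT_pos false).
  rewrite !lee_pdivlMr ?mul1e //; last exact: (OPT_pos false).
  by rewrite (OPT_BAD true) (OPT_BAD false).
move: ratioA; rewrite inver gt_eqF // -/D; apply/negP; rewrite -leNgt.
case E: rho rho1 => [r| |] // rho1.
  by apply: ratio_ge; rewrite ?E.
set q := approximation_ratio _ _ _ _.
have := ratio_ge 1 (lexx 1); rewrite E => /(_ rho1); rewrite -/q subrr mulr0 !mul0r addr0.
case Eq: q => [x| |] // q1; last by rewrite leey.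
exfalso; rewrite lee_fin in q1.
(* For infinite [rho], a finite ratio [x] is refuted by the [c] with [eps * (c - 1) * OPTa / D = x],
   whose bound is [1 + x]. *)
pose c := 1 + D * x / (eps * OPTa).
have c1 : 1 <= c.
  by rewrite lerDl divr_ge0 ?mulr_ge0 // ltW // (lt_le_trans ltr01).
have := ratio_ge c c1; rewrite E leey -/q Eq lee_fin => /(_ isT).
have -> : eps * (c - 1) * OPTa / D = x by rewrite /c; field; rewrite !gt_eqF.
by lra.
Qed.
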